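(* Let $\mu$ be a probability measure on $\mathbb R$ with moments $c_l(0):=\int x^l\,d\mu(x)$ satisfying $|c_l(0)|\le(cl)^l$ for all $l\ge0$ and some $c>0$, let $\nu_0\ge0$, and for $t\ge0$ let $\mu_t$ be the unique probability measure on $\mathbb R$ with moments $(c_l(t))_{l\ge0}$, where $c_0(t)=1$, $c_1(t)=c_1(0)$, and for $l\ge1$ $$c_{2l}(t)=c_{2l}(0)+2l\int_0^t\Bigl(\nu_0c_{2l-2}(s)+\sum_{h=0}^{l-1}c_{2h}(s)c_{2l-2h-2}(s)\Bigr)ds,$$ $$c_{2l+1}(t)=c_{2l+1}(0)+\int_0^t\Bigl(2l\nu_0c_{2l-1}(s)+4\sum_{h=0}^{l-1}(l-h)c_{2h}(s)c_{2l-2h-1}(s)\Bigr)ds.$$ Then the Stieltjes transforms $G^{even},G^{odd}$ of the even and odd parts of $\mu_t$ and the associated functions $\tilde G^{even},\tilde G^{odd}$ satisfy, for $t\ge0$ and $z\in H$, the PDEs $$\tilde G^{even}_t(t,z)=-2\nu_0\tilde G^{even}_z(t,z)-4z\tilde G^{even}_z(t,z)\tilde G^{even}(t,z)-2\tilde G^{even}(t,z)^2,$$ $$\tilde G^{odd}_t(t,z)=\bigl(-2\nu_0-4z\tilde G^{even}(t,z)\bigr)\tilde G^{odd}_z(t,z),$$ and $$G^{even}_t(t,z)=\nu_0\Bigl(\frac{G^{even}(t,z)}{z^2}-\frac{G^{even}_z(t,z)}{z}\Bigr)-2G^{even}(t,z)G^{even}_z(t,z),$$ $$G^{odd}_t(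t,z)=\Bigl(-\frac{\nu_0}{z}-2G^{even}(t,z)\Bigr)G^{odd}_z(t,z).$$
   Context: $H=\{z\in\mathbb C:\Im z>0\}$. The Stieltjes transform of a finite signed measure $\rho$ on $\mathbb R$ is $G_\rho(z)=\int\frac{1}{z-x}\,d\rho(x)$, $z\in\mathbb C\setminus\mathbb R$. With $\mu_t^*(A)=\mu_t(-A)$, put $\mu_{t,even}=\frac12(\mu_t+\mu_t^* )$, $\mu_{t,odd}=\frac12(\mu_t-\mu_t^* )$, $G^{even}(t,z)=G_{\mu_{t,even}}(z)$, $G^{odd}(t,z)=G_{\mu_{t,odd}}(z)$. The functions $\tilde G^{even},\tilde G^{odd}$ are defined on $\mathbb C\setminus[0,\infty[$ in the second variable by $G^{even}(t,z)=z\,\tilde G^{even}(t,z^2)$ and $G^{odd}(t,z)=\tilde G^{odd}(t,z^2)$ (formally $\tilde G^{even}(t,z)=\sum_{l\ge0}c_{2l}(t)z^{-l-1}$ and $\tilde G^{odd}(t,z)=\sum_{l\ge0}c_{2l+1}(t)z^{-l-1}$). Existence and uniqueness of the probability measures $\mu_t$ with moments $c_l(t)$ are known under the stated assumptions; the $c_l(t)$ are the limits as $N\to\infty$ of the expected moments of the empirical measures of the frozen Dunkl processes of type $B_N$ (components divided by $\sqrt N$) with parameter $\nu(N)$, $\nu(N)/N\to\nu_0$, and with initial empirical measures whose moments converge to those of $\mu$. Subscripts $t,z$ on $G,\tilde G$ denote partial derivatives; in the moment condition $(cl)^l:=1$ for $l=0$. *)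

(* Defs.v *)
From HB Require Import structures.
From mathcomp Require Import all_boot all_order all_algebra.
From mathcomp Require Import complex.
From mathcomp Require Import all_classical all_reals all_analysis measurable_realfun.

Set Implicit Arguments.
Unset Strict Implicit.
Unset Printing Implicit Defensive.
Import Order.TTheory GRing.Theory Num.Theory.
Import numFieldNormedType.Exports.
Local Open Scope classical_set_scope.
Local Open Scope ring_scope.
Local Open Scope complex_scope.

Definition has_moments (R : realType) (P : probability (measurableTypeR R) R)
    (m : nat -> R) : Prop :=
  forall l : nat,
    P.-integrable [set: measurableTypeR R] (fun x => (x ^+ l)%:E) /\
    \int[P]_x (x ^+ l) = m l.

(* Integration against a signed measure, through its Jordan decomposition.
   The Hahn decomposition chosen here is irrelevant: the two Jordan parts do
   not depend on it (Hahn_decomposition_uniq). *)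
Section charge_integral.
Context d (T : measurableType d) (R : realType).
Implicit Type rho : {charge set T -> \bar R}.

Definition hahn_pos rho : set T := projT1 (cid (Hahn_decomposition rho)).

Definition hahn_neg rho : set T :=
  projT1 (cid (projT2 (cid (Hahn_decomposition rho)))).

Definition hahn_posneg rho :
    hahn_decomposition rho (hahn_pos rho) (hahn_neg rho) :=
  projT2 (cid (projT2 (cid (Hahn_decomposition rho)))).

Definition charge_integral rho (f : T -> R) : R :=
  \int[jordan_pos (hahn_posneg rho)]_x f x
  - \int[jordan_neg (hahn_posneg rho)]_x f x.

Definition charge_cintegral rho (f : T -> R[i]) : R[i] :=
  charge_integral rho (fun x => complex.Re (f x))
  +i* charge_integral rho (fun x => complex.Im (f x)).

End charge_integral.

Definition stieltjes (R : realType)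
    (rho : {charge set (measurableTypeR R) -> \bar R}) (z : R[i]) : R[i] :=
  charge_cintegral rho (fun x : measurableTypeR R => (z - (x : R)%:C)^-1).

Section even_odd_parts.
Context (R : realType).

Definition real_opp : measurableTypeR R -> measurableTypeR R := -%R.

Let measurable_real_opp : measurable_fun [set: measurableTypeR R] real_opp.
Proof. exact: oppr_measurable. Qed.

HB.instance Definition _ :=
  isMeasurableFun.Build _ _ _ _ real_opp measurable_real_opp.

Variable P : probability (measurableTypeR R) R.

Definition reflection : probability (measurableTypeR R) R :=
  distribution P real_opp.

Definition even_part : {charge set (measurableTypeR R) -> \bar R} :=
  cscale 2^-1 (cadd (charge_of_finite_measure P)
                    (charge_of_finite_measure reflection)).

Definition odd_part : {charge set (measurableTypeR R) -> \bar R} :=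
  cscale 2^-1 (cadd (charge_of_finite_measure P)
                    (copp (charge_of_finite_measure reflection))).

Definition G_even : R[i] -> R[i] := stieltjes even_part.

Definition G_odd : R[i] -> R[i] := stieltjes odd_part.

End even_odd_parts.

(* The derivative at t of a function defined on [0, +oo[; it is one-sided at
   t = 0. *)
Definition is_time_derivative (R : realType) (f : R -> R[i]) (t : R)
    (l : R[i]) : Prop :=
  ((s - t)^-1%:C * (f s - f t) : R[i]^o)
    @[s --> within (fun s : R => 0 <= s) t^'] --> (l : R[i]^o).

Definition is_complex_derivative (R : realType) (f : R[i] -> R[i]) (z : R[i])
    (l : R[i]) : Prop :=
  is_derive (z : R[i]^o) (1 : R[i]^o) (f : R[i]^o -> R[i]^o) (l : R[i]^o).

(* Main.v *)
(** The moments of [mu_t] grow like [(K l) ^ l], so the expansion of the Stieltjes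
    transform in powers of [1 / z] diverges and the moment recursion cannot be
    summed.  Instead, write [p = x ^ 2]: then
    [tGeven t zeta = \int 1 / (zeta - x ^ 2) d(mu_t)] and
    [tGodd t zeta = \int x / (zeta - x ^ 2) d(mu_t)], and the recursion says that,
    for every polynomial [F] and [s = 0, 1],
      [d/dt \int x ^ s F(p) = 2 nu0 \int x ^ s F'(p) + \iint x ^ s (4 N - k_s S)(p, q)]
    with [k_0 = 2], [k_1 = 0], where [S] is the divided difference of [F] and
    [N = d/dp (p S)].  For [F(p) = 1 / (zeta - p)] one has [S = F(p) F(q)] and
    [N = zeta F(p) ^ 2 F(q)], so that this identity is exactly the PDE off the
    half-line; the equations for [G_even] and [G_odd] follow by substituting
    [zeta = z ^ 2].

    To pass from polynomials to the resolvent, note that the [c_l (t)] are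
    polynomials in [t] with [c_(2l) (t) <= A ^ l (2 l)!] locally uniformly in [t],
    so it suffices to approximate [F], [F'], [F''] by polynomials with an error
    controlled by [cosh (a x)] for some small [a].  For small [h], multiplication
    by [cos (h x)] maps the closure of the polynomials into itself (Taylor
    expansion); hence this closure contains all polynomials in [cos (h x)], then by
    Weierstrass all [G (2 (1 - cos (h x)) / h ^ 2)] with [G] Lipschitz, and, as [h]
    tends to 0, all [G (x ^ 2)].  Applying this to [G = F''] and integrating twice
    gives the approximation of [F], [F'], [F'']. *)
Require Import Defs.
From HB Require Import structures.
From mathcomp Require Import all_boot all_order all_algebra.
From mathcomp Require Import complex.
From mathcomp Require Import all_classical all_reals all_analysis measurable_realfun.
From mathcomp Require Import ring lra zify.
Set Implicit Arguments.
Unset Strict Implicit.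
Unset Printing Implicit Defensive.
Import Order.TTheory GRing.Theory Num.Theory.
Import numFieldNormedType.Exports.
Local Open Scope classical_set_scope.
Local Open Scope ring_scope.
Local Open Scope complex_scope.

(** The obstacle is uniformity: each approximation has to hold on the whole half-line, with an error
    whose integral against [mu_ t] is small for all [t] in a compact interval at once. The bound
    [A ^ l * (2 l)!] on the even moments is exactly what makes the partial sums of [cosh (a x)] have
    expectation at most 2 as soon as [a ^ 2 * A <= 1 / 2], whatever their order. No separate bound
    on odd moments is required, because [|x| <= 1 + x ^ 2]. [F''] has to be approximated because the
    diagonal value of [N] contains it. Starting from the highest derivative is safe: each
    integration from 0 costs one factor [p], absorbed by replacing [a ^ 2] by [4 * a ^ 2]. In time,
    the integral of a polynomial test function agrees for [t >= 0] with a polynomial in [t], whose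
    derivative is exactly the prescribed rate. Uniform convergence of these polynomials and of their
    derivatives on [[0, t + 1]] then yields the time derivative for the resolvent. The double
    integrals are iterated expectations of finite sums of products [f x * g y], so that for the
    resolvent they factor into products of transforms. *)

(** * Factorial estimates *)

Lemma expn_fact_le (m k : nat) : (m`! * m ^ k <= (m + k)`!)%N.
Proof.
elim: k => [|k IH]; first by rewrite muln1 addn0.
by rewrite expnSr mulnA addnS factS mulnC leq_mul// leqW// leq_addr.
Qed.

Lemma fact_add_le (m k : nat) : (m`! * k`! <= (m + k)`!)%N.
Proof.
rewrite -(@bin_fact (m + k) m) ?leq_addr// addKn.
by rewrite leq_pmull// bin_gt0 leq_addr.
Qed.

(** The binomial coefficient counts the subsets of a given size among the [2 ^ (m + k)] subsets of a
    set with [m + k] elements. *)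
Lemma fact_add_le_exp2 (m k : nat) : ((m + k)`! <= 2 ^ (m + k) * (m`! * k`!))%N.
Proof.
rewrite -{1}(@bin_fact (m + k) m) ?leq_addr// addKn leq_mul2r.
apply/orP; right; set N := (m + k)%N.
rewrite -[in X in (X <= _)%N](card_ord N) -cardsT -cards_draws.
rewrite -[X in (_ <= 2 ^ X)%N](card_ord N) -[in X in (_ <= X)%N]cardsT.
by rewrite -card_powerset subset_leq_card//; apply/fintype.subsetP => A; rewrite !inE => /andP[].
Qed.

(** Converts the hypothesis [(K l) ^ l] on the initial moments into factorial growth; it follows
    from [n! * n ^ n <= (2 n)! <= 4 ^ n * n! ^ 2]. *)
Lemma expn_self_le (n : nat) : (n ^ n <= 4 ^ n * n`!)%N.
Proof.
rewrite -(leq_pmul2l (fact_gt0 n)) (leq_trans (expn_fact_le n n))//.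
rewrite (leq_trans (fact_add_le_exp2 n n))// mulnCA leq_mul2l leq_mul2r.
by rewrite addnn -mul2n expnM leqnn !orbT.
Qed.


(** * Quantitative Weierstrass approximation *)

(** At [y] in [[0, 1]] this is the expectation of [g k] for [k] binomial with parameters [n] and
    [y], computed by conditioning on one trial; the recursion replaces the explicit Bernstein
    formula. *)
Fixpoint bernstein {R : nzRingType} (n : nat) (g : nat -> R) : {poly R} :=
  if n is m.+1 then
    'X * bernstein m (fun k => g k.+1) + (1 - 'X) * bernstein m g
  else (g 0%N)%:P.

(** The bracket [n y (1 - y) + (n y - a) ^ 2] is the second moment about [a] of the binomial law. A
    success in the conditioned trial shifts [g] by one, which is why [a] and [g] vary in the
    induction. *)
Lemma bernstein_dist (R : realFieldType) (y v al be : R) :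
    0 <= y <= 1 -> 0 <= be ->
  forall (n : nat) (a : R) (g : nat -> R),
    (forall k, `|g k - v| <= al + be * (k%:R - a) ^+ 2) ->
  `|(bernstein n g).[y] - v| <=
    al + be * (n%:R * y * (1 - y) + (n%:R * y - a) ^+ 2).
Proof.
move=> /andP[y0 y1] be0; elim=> [|n IH] a g Hg /=.
  rewrite hornerC (le_trans (Hg 0%N))// le_eqVlt; apply/orP; left; apply/eqP.
  by ring.
rewrite !hornerE.
have H1 := IH (a - 1) (fun k => g k.+1).
have H2 := IH a g Hg.
have {}H1 : `|(bernstein n (fun k => g k.+1)).[y] - v| <=
    al + be * (n%:R * y * (1 - y) + (n%:R * y - (a - 1)) ^+ 2).
  apply: H1 => k; have := Hg k.+1.
  by rewrite -natr1 (_ : k%:R + 1 - a = k%:R - (a - 1))//; ring.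
set u := (bernstein n _).[y] in H1 *; set w := (bernstein n g).[y] in H2 *.
have -> : y * u + (1 - y) * w - v = y * (u - v) + (1 - y) * (w - v) by ring.
rewrite (le_trans (ler_normD _ _))// !normrM (ger0_norm y0).
rewrite (@ger0_norm _ (1 - y)) ?subr_ge0//.
have := ler_wpM2l y0 H1; have : 0 <= 1 - y by rewrite subr_ge0.
move=> /ler_wpM2l/(_ _ _ H2) H2' H1'.
apply: le_trans (lerD H1' H2') _.
by rewrite -natr1 le_eqVlt; apply/orP; left; apply/eqP; ring.
Qed.

Lemma weierstrass_lipschitz (R : realType) (G : R -> R) (L M : R) :
    0 <= L -> 0 < M ->
    (forall x y : R, 0 <= x -> 0 <= y -> `|G x - G y| <= L * `|x - y|) ->
  forall e : R, 0 < e -> exists P : {poly R},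
    forall y : R, 0 <= y <= 1 -> `|G (M * y) - P.[y]| <= e.
Proof.
move=> L0 M0 GL e e0.
have L1 : 0 < 2 * (L + 1) by rewrite mulr_gt0// ltr_wpDl.
(* Scale at which the argument is split: [|t| <= d + t ^ 2 / d] always holds. The term [L * d] is at
   most [e / 2], and the quadratic term averages to [L * M ^ 2 * y * (1 - y) / (d * n)], which the
   choice of [N] makes at most [e / 2]. *)
pose d := e / (2 * (L + 1)).
have d0 : 0 < d by rewrite divr_gt0.
have [N] : exists N : nat, 2 * L * M ^+ 2 / (d * e) < N.+1%:R.
  exists (Num.trunc (2 * L * M ^+ 2 / (d * e))).
  by apply: truncnS_gt.
have N0 : 0 < N.+1%:R :> R by rewrite ltr0Sn.
set n : R := N.+1%:R in N0 *; rewrite ltr_pdivrMr ?(mulr_gt0 d0 e0)// => Hn.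
exists (bernstein N.+1 (fun k => G (M * (k%:R / n)))) => y y01.
rewrite distrC.
have := @bernstein_dist _ y (G (M * y)) (L * d) (L / d * (M / n) ^+ 2) y01 _
  N.+1 (n * y) (fun k => G (M * (k%:R / n))).
move=> H; apply: le_trans (H _ _) _.
- by rewrite mulr_ge0 ?sqr_ge0// divr_ge0// ltW.
- move=> k; case/andP: y01 => y0 y1.
  have kn0 : 0 <= M * (k%:R / n) by rewrite mulr_ge0 ?divr_ge0// ltW.
  have My0 : 0 <= M * y by rewrite mulr_ge0// ltW.
  apply: le_trans (GL _ _ kn0 My0) _.
  set t := M * (k%:R / n) - M * y.
  have -> : L / d * (M / n) ^+ 2 * (k%:R - n * y) ^+ 2 = L * (t ^+ 2 / d).
    by rewrite /t; field; rewrite !gt_eqF.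
  rewrite -mulrDr ler_wpM2l//.
  have [td|td] := leP `|t| d; first by rewrite (le_trans td)// lerDl divr_ge0 ?sqr_ge0// ltW.
  apply: (@le_trans _ _ (t ^+ 2 / d)); last by rewrite lerDr ltW.
  by rewrite ler_pdivlMr// -(real_normK (num_real t)) expr2 ler_wpM2l// ltW.
- rewrite -/n subrr expr0n addr0.
  case/andP: y01 => y0 y1.
  have yy : y * (1 - y) <= 1 by nra.
  have Ld : L * d <= e / 2.
    have -> : L * d = e / 2 - d.
      by rewrite /d; field; rewrite gt_eqF// ltr_wpDl.
    by rewrite gerBl ltW.
  suff : L / d * (M / n) ^+ 2 * (n * y * (1 - y)) <= e / 2.
    by move=> H2; apply: le_trans (lerD Ld H2) _; rewrite -splitr.
  have -> : L / d * (M / n) ^+ 2 * (n * y * (1 - y)) =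
    (L * M ^+ 2 / (d * n)) * (y * (1 - y)) by field; rewrite !gt_eqF.
  apply: (@le_trans _ _ (L * M ^+ 2 / (d * n))).
    apply: ler_piMr => //; apply: divr_ge0; first by rewrite mulr_ge0 ?sqr_ge0.
    by rewrite ltW// mulr_gt0.
  rewrite ler_pdivrMr; last exact: mulr_gt0.
  have -> : e / 2 * (d * n) = n * (d * e) / 2 by field.
  move: (ltW Hn); set u := n * (d * e); rewrite -mulrA; set v := L * M ^+ 2; lra.
Qed.

(** * Mean value inequalities, Taylor bounds for the cosine, and the weight *)

Lemma mean_value_bound (R : realType) (g dg : R -> R) (a b M : R) :
    a <= b -> {within `[a, b], continuous g} ->
    (forall x, x \in `]a, b[ -> is_derive x 1 g (dg x)) ->
    (forall x, x \in `]a, b[ -> `|dg x| <= M) ->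
  `|g b - g a| <= M * (b - a).
Proof.
move=> ab cg gd dgM; move: ab; rewrite le_eqVlt => /predU1P[<-|ab].
  by rewrite !subrr normr0 mulr0.
have [r rab ->] := MVT ab gd cg.
by rewrite normrM [X in _ * X]gtr0_norm ?subr_gt0// ler_pM2r ?subr_gt0// dgM.
Qed.

Lemma mean_value_compare (R : realType) (g dg h dh : R -> R) (b : R) :
    0 <= b -> g 0 = 0 -> h 0 = 0 ->
    (forall x, is_derive x (1 : R) g (dg x)) ->
    (forall x, is_derive x (1 : R) h (dh x)) ->
    (forall x, 0 <= x -> `|dg x| <= dh x) ->
  `|g b| <= h b.
Proof.
move=> b0 g0 h0 gd hd gh; move: b0; rewrite le_eqVlt => /predU1P[<-|b0].
  by rewrite g0 h0 normr0.
have cont (f df : R -> R) : (forall x, is_derive x (1 : R) f (df x)) ->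
    {within `[0, b], continuous f}.
  move=> fd; apply: continuous_subspaceT => x.
  by apply/differentiable_continuous/derivable1_diffP; have [] := fd x.
have main (s : R) : `|s| = 1 -> 0 <= h b - s * g b.
  move=> s1.
  have hsd x : is_derive x (1 : R) (h - s *: g) (dh x - s * dg x).
    by apply: is_deriveB.
  have [r] := MVT b0 (fun x _ => hsd x) (cont _ _ hsd).
  rewrite in_itv/= => /andP[r0 _].
  rewrite /= -![(_ - _ *: _) _]/(_ - _ * _) g0 h0 mulr0 !subr0 => ->.
  rewrite mulr_ge0 ?(ltW b0)// subr_ge0.
  apply: le_trans (gh _ (ltW r0)).
  by rewrite (le_trans (ler_norm _))// normrM s1 mul1r.
rewrite ler_norml; apply/andP; split.
  by have := main (-1); rewrite normrN1 => /(_ erefl); rewrite mulN1r opprK; lra.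
by have := main 1; rewrite normr1 => /(_ erefl); rewrite mul1r; lra.
Qed.

(** The variable stands for the square of the argument of the cosine, so that the result is a
    polynomial in [p = x ^ 2]. *)
Definition cos_taylor {R : realType} (n : nat) : {poly R} :=
  \sum_(k < n) ((-1) ^+ k / (k.*2)`!%:R) *: 'X^k.

(** Each bound is the primitive of the previous one: the cosine bound of order [n] gives the sine
    bound of order [n], which gives the cosine bound of order [n + 1]. *)
Lemma cos_sin_taylor_bound (R : realType) (n : nat) (y : R) : 0 <= y ->
  let C : {poly R} := \sum_(k < n) ((-1) ^+ k / (k.*2)`!%:R) *: 'X^(k.*2) in
  let S : {poly R} :=
    \sum_(k < n) ((-1) ^+ k / (k.*2.+1)`!%:R) *: 'X^(k.*2.+1) in
  `|cos y - C.[y]| <= y ^+ n.*2 / (n.*2)`!%:R /\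
  `|sin y - S.[y]| <= y ^+ n.*2.+1 / (n.*2.+1)`!%:R.
Proof.
have facr (m : nat) : (m.+1)`!%:R^-1 * m.+1%:R = m`!%:R^-1 :> R.
  by rewrite factS natrM invfM mulrAC mulVf ?mul1r// pnatr_eq0.
have powd (m : nat) (x : R) :
    is_derive x (1 : R) (fun y : R => y ^+ m.+1 / (m.+1)`!%:R) (x ^+ m / m`!%:R).
  have -> : (fun y : R => y ^+ m.+1 / (m.+1)`!%:R) = horner (((m.+1)`!%:R^-1 : R) *: 'X^(m.+1)).
    by apply/funext => u; rewrite !hornerE ?hornerXn mulrC.
  apply: is_derive_eq; rewrite derivZ derivXn hornerZ hornerMn hornerXn /= -[_ *+ m.+1]mulr_natr.
  by rewrite mulrCA facr.
have sinstep (m : nat) : let C : {poly R} := \sum_(k < m) ((-1) ^+ k / (k.*2)`!%:R) *: 'X^(k.*2) in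
  let S : {poly R} :=
    \sum_(k < m) ((-1) ^+ k / (k.*2.+1)`!%:R) *: 'X^(k.*2.+1) in
  (forall y : R, 0 <= y -> `|cos y - C.[y]| <= y ^+ m.*2 / (m.*2)`!%:R) ->
  forall y : R, 0 <= y -> `|sin y - S.[y]| <= y ^+ m.*2.+1 / (m.*2.+1)`!%:R.
  move=> C S HC z z0.
  have SC : S^`() = C.
    rewrite /S raddf_sum; apply: eq_bigr => k _ /=.
    rewrite derivZ derivXn /= -[_ *+ _.+1]scaler_nat scalerA; congr (_ *: _).
    by rewrite -mulrA facr.
  apply: (@mean_value_compare _ (fun y => sin y - S.[y]) (fun y => cos y - C.[y])
    (fun y => y ^+ m.*2.+1 / (m.*2.+1)`!%:R) (fun y => y ^+ m.*2 / (m.*2)`!%:R)) => //.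
  - rewrite sin0 sub0r /S horner_sum big1 ?oppr0// => k _.
    by rewrite !hornerE ?hornerXn expr0n mulr0.
  - by rewrite expr0n mul0r.
  - by move=> x; rewrite -SC; apply: is_deriveB.
move=> y0 C S; suff H : forall y : R, 0 <= y -> `|cos y - C.[y]| <= y ^+ n.*2 / (n.*2)`!%:R.
  by split; [exact: H|exact: sinstep H _ y0].
move=> {y y0}; rewrite {}/C {S}; elim: n => [|n IH] y y0.
  by rewrite big_ord0 hornerC subr0 expr0 fact0 divr1 cos_max.
have {IH}HS := sinstep n IH.
set S : {poly R} := \sum_(k < n) _ *: 'X^(_.+1) in HS.
set C : {poly R} := \sum_(k < n.+1) _.
have CS : C^`() = - S.
  rewrite /C raddf_sum big_ord_recl /= derivZ derivC scaler0 add0r -sumrN.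
  apply: eq_bigr => k _ /=; rewrite derivZ derivXn /=.
  rewrite -[_ *+ (bump _ _).*2]scaler_nat scalerA -scaleNr; congr (_ *: _).
  by rewrite /bump /= add1n doubleS -mulrA facr exprS mulN1r mulNr.
apply: (@mean_value_compare _ (fun y => cos y - C.[y]) (fun y => - sin y - (- S).[y])
    (fun y => y ^+ n.*2.+2 / (n.*2.+2)`!%:R) (fun y => y ^+ n.*2.+1 / (n.*2.+1)`!%:R)) => //.
- rewrite cos0 /C horner_sum big_ord_recl big1 => [|k _]; last first.
    by rewrite hornerZ hornerXn lift0 doubleS expr0n mulr0.
  by rewrite hornerZ hornerXn /= !expr0 fact0 divr1 mulr1 addr0 subrr.
- by rewrite expr0n mul0r.
- by move=> x; rewrite -CS; apply: is_deriveB.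
- by move=> x x0; rewrite hornerN -opprD normrN; exact: HS.
Qed.

Lemma cos_taylor_bound (R : realType) (n : nat) (y : R) :
  `|cos y - (cos_taylor n).[y ^+ 2]| <= (y ^+ 2) ^+ n / (n.*2)`!%:R.
Proof.
have [+ _] := @cos_sin_taylor_bound R n `|y| (normr_ge0 y).
have pow2 (k : nat) : `|y| ^+ k.*2 = (y ^+ 2) ^+ k.
  by rewrite -mul2n exprM real_normK ?num_real.
rewrite cos_norm !pow2 /cos_taylor !horner_sum.
under eq_bigr do rewrite hornerZ hornerXn pow2.
by under [in X in _ -> X]eq_bigr do rewrite hornerZ hornerXn.
Qed.

(* A partial sum of [cosh (sqrt (b * p))].  A polynomial weight, instead of
   [exp (a * `|x|)], makes every integral below a finite combination of moments. *)
Definition weight {R : realType} (b : R) (n : nat) (p : R) : R :=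
  \sum_(k < n.+1) b ^+ k * p ^+ k / (k.*2)`!%:R.

Lemma weight_ge1 (R : realType) (b : R) (n : nat) (p : R) : 0 <= b -> 0 <= p ->
  1 <= weight b n p.
Proof.
move=> b0 p0; rewrite /weight big_ord_recl /= !expr0 mulr1 fact0 divr1 lerDl.
by apply: sumr_ge0 => k _; rewrite !mulr_ge0 ?exprn_ge0// invr_ge0.
Qed.

Lemma weight_ge0 (R : realType) (b : R) (n : nat) (p : R) : 0 <= b -> 0 <= p ->
  0 <= weight b n p.
Proof. by move=> b0 p0; rewrite (le_trans _ (weight_ge1 _ b0 p0)). Qed.

Lemma weight_homo (R : realType) (b c : R) (n m : nat) (p q : R) :
  0 <= b <= c -> (n <= m)%N -> 0 <= p <= q -> weight b n p <= weight c m q.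
Proof.
move=> /andP[b0 bc] nm /andP[p0 pq]; have c0 := le_trans b0 bc.
have q0 := le_trans p0 pq.
rewrite /weight (big_ord_widen _ (fun k => b ^+ k * p ^+ k / (k.*2)`!%:R) (nm : (n.+1 <= m.+1)%N)).
rewrite [leRHS](bigID (fun k : 'I_m.+1 => (k < n.+1)%N))/= -[leLHS]addr0.
apply: lerD; last by apply: sumr_ge0 => k _; rewrite !mulr_ge0 ?exprn_ge0// invr_ge0.
apply: ler_sum => k _; rewrite ler_pM2r ?invr_gt0 ?ltr0n ?fact_gt0//.
by rewrite ler_pM ?exprn_ge0// lerXn2r// nnegrE.
Qed.

Lemma weight_term (R : realType) (b : R) (n k : nat) (p : R) : 0 <= b -> 0 <= p -> (k <= n)%N ->
  b ^+ k * p ^+ k / (k.*2)`!%:R <= weight b n p.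
Proof.
move=> b0 p0 kn; rewrite /weight (bigD1 (Ordinal (kn : (k < n.+1)%N)))//= lerDl.
by apply: sumr_ge0 => i _; rewrite !mulr_ge0 ?exprn_ge0// invr_ge0.
Qed.

(** Comparing coefficients, this is [(2 k + 2) * (2 k + 1) <= 4 ^ (k + 1)]. It is the source of all
    later multiplications of [b] by 4. *)
Lemma mul_weight_le (R : realType) (b : R) (n : nat) (p : R) : 0 < b -> 0 <= p ->
  p * weight b n p <= b^-1 * weight (4 * b) n.+1 p.
Proof.
move=> b0 p0; rewrite mulrC ler_pdivlMl// mulrCA.
rewrite /weight mulr_suml [leRHS]big_ord_recl -[leLHS]add0r lerD//.
  by rewrite !mulr_ge0 ?exprn_ge0 ?mulr_ge0 ?invr_ge0// ltW.
apply: ler_sum => k _; rewrite /= /bump /= add1n.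
have -> : b ^+ k * p ^+ k / (k.*2)`!%:R * (b * p) =
   (b * p) ^+ k.+1 / (k.*2)`!%:R by rewrite exprS exprMn; ring.
have -> : (4 * b) ^+ k.+1 * p ^+ k.+1 = 4 ^+ k.+1 * (b * p) ^+ k.+1.
  by rewrite !exprMn mulrA.
rewrite mulrAC mulrC ler_wpM2r ?exprn_ge0 ?mulr_ge0 ?(ltW b0)//.
have f0 (m : nat) : 0 < m`!%:R :> R by rewrite ltr0n fact_gt0.
rewrite ler_pdivlMr// mulrC ler_pdivrMr// -natrX -natrM ler_nat.
rewrite doubleS !factS mulnA leq_mul2r; apply/orP; right.
elim: (k : nat) => [|m IH] //; rewrite doubleS expnS.
case: m IH => // m; set E := (4 ^ _)%N => IH; rewrite -muln2 in IH *; nia.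
Qed.

(** * The weighted closure of the polynomials in [x ^ 2] *)

(** The order [n] of the weight may depend on [e]: this is harmless because the weights are later
    integrated with a bound independent of [n]. *)
Definition approximable {R : realType} (b : R) (f : R -> R) : Prop :=
  forall e : R, 0 < e -> exists (P : {poly R}) (n : nat),
    forall x, `|f x - P.[x ^+ 2]| <= e * weight b n (x ^+ 2).

Section approximable.
Variables (R : realType) (b : R).
Hypothesis b0 : 0 < b.
Implicit Types (f g : R -> R) (P Q : {poly R}).

Let bge0 : 0 <= b. Proof. exact: ltW. Qed.

Lemma weight_monotone (n m : nat) (x : R) : (n <= m)%N ->
  weight b n (x ^+ 2) <= weight b m (x ^+ 2).
Proof. by move=> nm; rewrite weight_homo ?lexx ?bge0 ?sqr_ge0. Qed.

Lemma approximable_poly P : approximable b (fun x => P.[x ^+ 2]).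
Proof.
move=> e e0; exists P, 0%N => x; rewrite subrr normr0.
by rewrite mulr_ge0 ?weight_ge0 ?sqr_ge0 ?(ltW e0).
Qed.

Lemma eq_approximable f g : f =1 g -> approximable b f -> approximable b g.
Proof. by move=> /funext ->. Qed.

Lemma approximable_lim f :
  (forall e : R, 0 < e -> exists2 g, approximable b g & exists n,
     forall x, `|f x - g x| <= e * weight b n (x ^+ 2)) ->
  approximable b f.
Proof.
move=> H e e0; have e2 : 0 < e / 2 by rewrite divr_gt0.
have [g /(_ _ e2)[P [m gP]] [n fg]] := H _ e2.
exists P, (maxn n m) => x; rewrite [e]splitr mulrDl.
rewrite -(subrK (g x) (f x)) -addrA (le_trans (ler_normD _ _))// lerD//.
  by rewrite (le_trans (fg x))// ler_pM2l// weight_monotone ?leq_maxl.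
by rewrite (le_trans (gP x))// ler_pM2l// weight_monotone ?leq_maxr.
Qed.

Lemma approximableD f g : approximable b f -> approximable b g ->
  approximable b (fun x => f x + g x).
Proof.
move=> Hf Hg e e0; have e2 : 0 < e / 2 by rewrite divr_gt0.
have [P [n fP]] := Hf _ e2; have [Q [m gQ]] := Hg _ e2.
exists (P + Q), (maxn n m) => x; rewrite hornerD opprD addrACA [e]splitr mulrDl.
rewrite (le_trans (ler_normD _ _))// lerD//.
  by rewrite (le_trans (fP x))// ler_pM2l// weight_monotone ?leq_maxl.
by rewrite (le_trans (gQ x))// ler_pM2l// weight_monotone ?leq_maxr.
Qed.

(* A bounded multiplier preserves the closure of the polynomials as soon as it
   maps the polynomials into it. *)
Lemma approximable_mul (m : R -> R) f :
    (forall x, `|m x| <= 1) ->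
    (forall P, approximable b (fun x => m x * P.[x ^+ 2])) ->
  approximable b f -> approximable b (fun x => m x * f x).
Proof.
move=> m1 mP Hf; apply: approximable_lim => e e0.
have [P [n fP]] := Hf _ e0.
exists (fun x => m x * P.[x ^+ 2]) => //; exists n => x.
by rewrite -mulrBr normrM (le_trans _ (fP x))// ler_piMl.
Qed.

(* The remainder of the Taylor polynomial of the cosine is absorbed by the weight
   because ['C(2 n + 2 m, 2 m) <= 4 ^ (n + m)] while [h ^ 2 <= b / 8]. *)
Lemma approximable_cos_monomial (h : R) (a : R) (m : nat) : h ^+ 2 <= b / 8 ->
  approximable b (fun x => cos (h * x) * (a * (x ^+ 2) ^+ m)).
Proof.
move=> hb e e0.
(* In [h ^ 2 <= b / 8] write [8 = 2 * 4]: the factor 4 pays for the binomial coefficient and the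
   factor 2 leaves the decay [2 ^ - n]; [C] collects what depends on [a] and [m] only. *)
pose C : R := (`|a| + 1) * (4 ^+ m * (m.*2)`!%:R / b ^+ m).
have C0 : 0 < C.
  by rewrite mulr_gt0 ?ltr_wpDl// divr_gt0 ?exprn_gt0// mulr_gt0 ?exprn_gt0.
have [n nC] : exists n : nat, C / 2 ^+ n <= e.
  exists (Num.trunc (C / e)).+1.
  rewrite ler_pdivrMr ?exprn_gt0// -ler_pdivrMl// mulrC.
  apply: le_trans (ltW (truncnS_gt _)) _.
  by rewrite -natrX ler_nat; apply: ltnW; apply: ltn_expl.
exists (a *: 'X^m * (cos_taylor n \Po (h ^+ 2 *: 'X))), (n + m)%N => x.
rewrite hornerM horner_comp !hornerZ hornerXn hornerX [X in _ - X]mulrC -mulrBl.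
set p := x ^+ 2; have p0 : 0 <= p by exact: sqr_ge0.
rewrite normrM.
have := cos_taylor_bound n (h * x).
rewrite [(h * x) ^+ 2]exprMn -/p => Hu; clearbody p.
have Ha : `|a * p ^+ m| <= (`|a| + 1) * p ^+ m.
  rewrite normrM (ger0_norm (exprn_ge0 m p0)).
  by rewrite ler_wpM2r ?exprn_ge0// lerDl.
apply: le_trans (ler_pM _ _ Hu Ha) _ => //; rewrite ?normr_ge0//.
have f0 (k : nat) : 0 < k`!%:R :> R by rewrite ltr0n fact_gt0.
have binb : ((n + m).*2)`!%:R <= 4 ^+ (n + m) * ((n.*2)`!%:R * (m.*2)`!%:R) :> R.
  rewrite -natrX -!natrM ler_nat doubleD (leq_trans (fact_add_le_exp2 _ _))//.
  by rewrite -doubleD -mul2n expnM.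
have hn : (h ^+ 2) ^+ n <= (b / 8) ^+ n.
  by rewrite lerXn2r ?nnegrE ?sqr_ge0// divr_ge0.
have F0 : 0 < 4 ^+ (n + m) * ((n.*2)`!%:R * (m.*2)`!%:R) :> R.
  by rewrite !mulr_gt0 ?exprn_gt0.
have key : (b / 8) ^+ n * p ^+ n / (n.*2)`!%:R * ((`|a| + 1) * p ^+ m) =
    C / 2 ^+ n * (b ^+ (n + m) * p ^+ (n + m) / (4 ^+ (n + m) * ((n.*2)`!%:R * (m.*2)`!%:R))).
  rewrite /C !exprD -[8](_ : 2 * 4 = 8); last by rewrite -natrM.
  rewrite exprMn invfM exprMn !exprVn.
  move: (f0 n.*2) (f0 m.*2) (exprn_gt0 n (ltr0n R 4)) (exprn_gt0 n (ltr0n R 2)) => *.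
  field.
  by rewrite !gt_eqF ?exprn_gt0.
apply: (@le_trans _ _ ((b / 8) ^+ n * p ^+ n / (n.*2)`!%:R * ((`|a| + 1) * p ^+ m))).
  rewrite exprMn ler_wpM2r ?mulr_ge0 ?exprn_ge0 ?addr_ge0//.
  by rewrite ler_pM2r ?invr_gt0// ler_wpM2r ?exprn_ge0.
rewrite key; apply: ler_pM => //.
- by rewrite divr_ge0 ?(ltW C0) ?exprn_ge0.
- by rewrite divr_ge0 ?(ltW F0)// mulr_ge0 ?exprn_ge0.
- apply: le_trans (weight_term bge0 p0 (leqnn _)).
  by rewrite ler_wpM2l ?mulr_ge0 ?exprn_ge0// lef_pV2 ?posrE.
Qed.

Lemma approximable_cos_poly (h : R) P : h ^+ 2 <= b / 8 ->
  approximable b (fun x => cos (h * x) * P.[x ^+ 2]).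
Proof.
move=> hb; rewrite -[P]coefK poly_def.
elim: (size P) => [|n IH].
  rewrite big_ord0; apply: eq_approximable (approximable_poly 0) => x.
  by rewrite !horner0 mulr0.
apply: eq_approximable (approximableD IH (approximable_cos_monomial P`_n n hb)).
by move=> x; rewrite big_ord_recr/= hornerD hornerZ hornerXn mulrDr.
Qed.

Lemma approximable_polycos (h : R) Q : h ^+ 2 <= b / 8 ->
  approximable b (fun x => Q.[cos (h * x)]).
Proof.
move=> hb; elim/poly_ind: Q => [|Q a IH].
  by apply: eq_approximable (approximable_poly 0) => x; rewrite !horner0.
suff H : approximable b (fun x => cos (h * x) * Q.[cos (h * x)]).
  apply: eq_approximable (approximableD H (approximable_poly a%:P)) => x.
  by rewrite hornerD hornerMX !hornerC mulrC.
apply: approximable_mul => // [x|P]; first exact: cos_max.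
exact: approximable_cos_poly.
Qed.

(* [2 * (1 - cos (h * x)) / h ^ 2] is a bounded substitute for [x ^ 2] to which
   the Weierstrass theorem applies, and it tends to [x ^ 2] as [h] tends to 0. *)
Lemma approximable_lipschitz (G : R -> R) (L : R) : 0 <= L ->
    (forall x y : R, 0 <= x -> 0 <= y -> `|G x - G y| <= L * `|x - y|) ->
  approximable b (fun x => G (x ^+ 2)).
Proof.
move=> L0 GL; apply: approximable_lim => e e0.
have [h h0 [hb hL]] : exists2 h : R, 0 < h & h ^+ 2 <= b / 8 /\ L * h ^+ 2 * 2 / b ^+ 2 <= e / 2.
  (* The first bound lets [cos (h * x)] act on the closure. The second controls the replacement of
     [p] by [2 * (1 - cos (h * x)) / h ^ 2]: its cost [L * h ^ 2 * p ^ 2 / 12] is at most [e / 2]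
     times the term [b ^ 2 * p ^ 2 / 24] of the weight. *)
  pose s := Num.min (b / 8) (e * b ^+ 2 / (4 * (L + 1))).
  have L1 : 0 < 4 * (L + 1) by rewrite mulr_gt0// ltr_wpDl.
  have b2 : 0 < b ^+ 2 by rewrite exprn_gt0.
  have s0 : 0 < s by rewrite lt_min !divr_gt0// mulr_gt0.
  exists (Num.sqrt s); first by rewrite sqrtr_gt0.
  rewrite (sqr_sqrtr (ltW s0)); split; first by rewrite ge_min lexx.
  have : s <= e * b ^+ 2 / (4 * (L + 1)) by rewrite ge_min lexx orbT.
  rewrite ler_pdivlMr// => Hs; rewrite ler_pdivrMr//.
  by move: Hs (ltW s0); set v := b ^+ 2; nra.
have h2 : 0 < h ^+ 2 by rewrite exprn_gt0.
have M0 : 0 < 4 / h ^+ 2 by rewrite divr_gt0.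
have e2 : 0 < e / 2 by rewrite divr_gt0.
have [P HP] := weierstrass_lipschitz L0 M0 GL e2.
exists (fun x => (P \Po (2^-1 *: (1 - 'X))).[cos (h * x)]).
  exact: approximable_polycos.
exists 2%N => x; rewrite horner_comp hornerZ hornerD hornerN hornerC hornerX.
set y : R := 2^-1 * (1 - _).
have y01 : 0 <= y <= 1.
  have := cos_le1 (h * x); have := cos_geN1 (h * x); rewrite /y => *.
  by apply/andP; split; lra.
set p := x ^+ 2; have p0 : 0 <= p by exact: sqr_ge0.
rewrite -(subrK (G (4 / h ^+ 2 * y)) (G p)) -addrA (le_trans (ler_normD _ _))//.
apply: (@le_trans _ _ (e / 2 * weight b 2 p + e / 2 * weight b 2 p)).
  2: by rewrite -mulrDl -splitr.
apply: lerD; last first.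
  by rewrite (le_trans (HP _ y01))// ler_peMr ?(ltW e2)// weight_ge1.
have My0 : 0 <= 4 / h ^+ 2 * y by rewrite mulr_ge0 ?(ltW M0)//; case/andP: y01.
apply: le_trans (GL _ _ p0 My0) _.
have := cos_taylor_bound 2 (h * x).
have -> (u : R) : (cos_taylor 2).[u] = 1 - u / 2.
  rewrite /cos_taylor !big_ord_recl big_ord0 addr0 hornerD !hornerZ !hornerXn.
  by rewrite /= expr0 expr1 fact0 divr1 mulr1 (_ : _`! = 2%N)//; ring.
rewrite [(h * x) ^+ 2]exprMn -/p => Hc; clearbody p.
have -> : p - 4 / h ^+ 2 * y = (cos (h * x) - (1 - h ^+ 2 * p / 2)) * (2 / h ^+ 2).
  by rewrite /y; field; rewrite gt_eqF.
have d2 : 0 < 2 / h ^+ 2 by rewrite divr_gt0.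
rewrite normrM (gtr0_norm d2).
have Hw := weight_term bge0 p0 (leqnn 2).
have b2 : 0 < b ^+ 2 by rewrite exprn_gt0.
rewrite (_ : (2.*2)`! = 24%N)// in Hc Hw.
apply: (@le_trans _ _ (L * h ^+ 2 * 2 / b ^+ 2 * (b ^+ 2 * p ^+ 2 / 24%:R))); last first.
  apply: ler_pM => //.
    by apply: divr_ge0; rewrite ?(ltW b2)// !mulr_ge0// ltW.
  by apply: divr_ge0 => //; rewrite mulr_ge0 ?exprn_ge0// ltW.
have -> : L * h ^+ 2 * 2 / b ^+ 2 * (b ^+ 2 * p ^+ 2 / 24%:R) =
    L * ((h ^+ 2 * p) ^+ 2 / 24%:R * (2 / h ^+ 2)).
  by field; rewrite !gt_eqF.
by rewrite ler_wpM2l// ler_pM2r.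
Qed.

End approximable.

(** * Calculus on the half-line: approximation with two derivatives, divided differences *)

(** Only nonnegative points are tested: for a negative real [zeta], which occurs among the squares
    [z ^ 2], the function [1 / (zeta - p)] has a pole at a negative [p]. The quadratic remainder
    includes the endpoint 0 without one-sided derivatives. *)
Definition halfline_derivative (R : realType) (F F1 : R -> R) : Prop :=
  exists C : R, forall p q : R, 0 <= p -> 0 <= q ->
    `|F q - F p - F1 p * (q - p)| <= C * (q - p) ^+ 2.

Definition halfline_C1 (R : realType) (F F1 : R -> R) : Prop :=
  (forall x : R, 0 < x -> is_derive x (1 : R) F (F1 x)) /\
  (forall a b : R, 0 <= a -> {within `[a, b], continuous F}).

Lemma halfline_derivative_C1 (R : realType) (F F1 : R -> R) :
  halfline_derivative F F1 -> halfline_C1 F F1.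
Proof.
move=> [C0 HC0]; pose C : R := `|C0| + 1.
have C_gt0 : 0 < C by rewrite ltr_wpDl.
have HC (p q : R) : 0 <= p -> 0 <= q -> `|F q - F p - F1 p * (q - p)| <= C * (q - p) ^+ 2.
  move=> p0 q0; apply: le_trans (HC0 _ _ p0 q0) _; rewrite ler_wpM2r ?sqr_ge0//.
  by rewrite (le_trans (ler_norm _))// lerDl.
split=> [x x0|a b a0].
  have cvg : h^-1 *: ((F \o shift x) (h *: 1) - F x) @[h --> 0^'] --> F1 x.
    apply/cvgrPdist_le => /= e e0; near=> h.
    have h0 : h != 0 by near: h; exact: nbhs_dnbhs_neq.
    have hx : `|h| < x by near: h; apply: dnbhs0_lt.
    have he : `|h| <= e / C by near: h; apply: dnbhs0_le; rewrite divr_gt0.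
    rewrite -![_ *: _]/(_ * _) mulr1.
    have xh0 : 0 <= h + x by move: hx; rewrite ltr_norml => /andP[? _]; lra.
    have := HC _ _ (ltW x0) xh0; rewrite addrK => H.
    have -> : F1 x - h^-1 * (F (h + x) - F x) = - h^-1 * (F (h + x) - F x - F1 x * h).
      by field.
    rewrite normrM normrN normfV ler_pdivrMl ?normr_gt0//.
    apply: le_trans H _; rewrite -real_normK ?num_real// expr2 mulrCA ler_wpM2l//.
    by rewrite mulrC -ler_pdivlMr.
  apply: DeriveDef; first exact: cvgP cvg.
  exact: cvg_lim cvg.
apply/subspace_continuousP => x; rewrite /= in_itv/= => /andP[ax xb].
have x0 := le_trans a0 ax.
apply/cvgrPdist_le => /= e e0.
pose M : R := `|F1 x| + C.
have M0 : 0 < M by rewrite ltr_wpDl.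
rewrite near_withinE; near=> y => yab.
have y0 : 0 <= y by move: yab; rewrite /= in_itv/= => /andP[ay _]; exact: le_trans ay.
have y1 : `|x - y| <= 1 by near: y; apply: cvgr_dist_le => //; exact: cvg_id.
have ye : `|x - y| <= e / M.
  by near: y; apply: cvgr_dist_le; [exact: cvg_id|rewrite divr_gt0].
have := HC _ _ x0 y0.
have -> : F y - F x - F1 x * (y - x) = - ((F x - F y) - F1 x * (x - y)) by ring.
rewrite normrN => H.
rewrite -(subrK (F1 x * (x - y)) (F x - F y)) (le_trans (ler_normD _ _))//.
rewrite (le_trans (lerD H (lexx _)))// normrM -[(y - x) ^+ 2]real_normK ?num_real// distrC.
rewrite (_ : e = M * (e / M)); last by rewrite mulrC divfK ?gt_eqF.
apply: (@le_trans _ _ (M * `|x - y|)); last by rewrite ler_pM2l.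
rewrite /M (mulrDl `|F1 x|) [leRHS]addrC lerD2r ler_pM2l// expr2.
by rewrite ler_piMl.
Unshelve. all: by end_near. Qed.

Lemma halfline_C1_horner (R : realType) (P : {poly R}) :
  halfline_C1 (horner P) (horner P^`()).
Proof.
split=> [x _|a b _]; first by apply: is_derive_eq.
apply: continuous_subspaceT => x.
by apply/differentiable_continuous/derivable1_diffP/derivable_horner.
Qed.

Lemma halfline_C1B (R : realType) (F F1 G G1 : R -> R) :
  halfline_C1 F F1 -> halfline_C1 G G1 ->
  halfline_C1 (fun x => F x - G x) (fun x => F1 x - G1 x).
Proof.
move=> [dF cF] [dG cG]; split=> [x x0|a b a0].
  by apply: is_deriveB; [exact: dF|exact: dG].
by move=> x; apply: cvgB; [exact: cF|exact: cG].
Qed.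

Lemma halfline_mean_value (R : realType) (F F1 : R -> R) (M p q : R) :
    halfline_C1 F F1 -> 0 <= p -> 0 <= q ->
    (forall r : R, Num.min p q <= r <= Num.max p q -> `|F1 r| <= M) ->
  `|F p - F q| <= M * `|p - q|.
Proof.
move=> [dF cF]; wlog pq : p q / p <= q.
  move=> H p0 q0 HM; have [|/ltW] := leP p q => pq; first exact: H.
  by rewrite distrC [`|p - q|]distrC H// => r; rewrite minC maxC; exact: HM.
move=> p0 q0 HM; rewrite distrC [`|p - q|]distrC [`|q - p|]ger0_norm ?subr_ge0//.
apply: (@mean_value_bound _ F F1) => //; first exact: cF.
  by move=> x; rewrite in_itv/= => /andP[px _]; apply: dF; exact: le_lt_trans px.
move=> x; rewrite in_itv/= => /andP[px xq]; apply: HM.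
by rewrite (min_idPl pq) (max_idPr pq) (ltW px) (ltW xq).
Qed.

Lemma poly_primitive (R : realType) (Q : {poly R}) :
  exists2 P : {poly R}, P^`() = Q & P.[0] = 0.
Proof.
exists (\sum_(i < size Q) (Q`_i / i.+1%:R) *: 'X^(i.+1)).
  rewrite raddf_sum -[RHS]coefK poly_def; apply: eq_bigr => i _ /=.
  rewrite derivZ derivXn /= -scalerMnr scalerMnl -mulr_natr divfK//.
by rewrite horner_sum big1// => i _; rewrite hornerZ hornerXn expr0n mulr0.
Qed.

(** [F''] is approximated first and the polynomial is integrated twice with the initial values
    [F1 0] and [F 0], so that the errors vanish at 0. Each integration multiplies the error by [p],
    and the weight passes from [b] to [4 * b] to [16 * b]. *)
Lemma approximation_C2 (R : realType) (b L : R) (F F1 F2 : R -> R) :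
    0 < b -> 0 <= L -> halfline_derivative F F1 -> halfline_derivative F1 F2 ->
    (forall p q : R, 0 <= p -> 0 <= q -> `|F2 p - F2 q| <= L * `|p - q|) ->
  forall e : R, 0 < e -> exists (P : {poly R}) (n : nat), forall p, 0 <= p ->
    [/\ `|F p - P.[p]| <= e * weight (16 * b) n p,
        `|F1 p - P^`().[p]| <= e * weight (16 * b) n p &
        `|F2 p - P^`()^`().[p]| <= e * weight (16 * b) n p].
Proof.
move=> b0 L0 /halfline_derivative_C1 dF /halfline_derivative_C1 dF1 F2L e e0.
(* One summand for each of the losses in the bounds on [F2], [F1] and [F]. *)
pose C : R := 1 + b^-1 + b^-1 * (4 * b)^-1.
have bb0 : 0 < 4 * b by rewrite mulr_gt0.
have C0 : 0 < C by rewrite !addr_gt0 ?mulr_gt0 ?invr_gt0.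
pose d := e / C; have d0 : 0 < d by rewrite divr_gt0.
have [Q [n HQ]] := approximable_lipschitz b0 L0 F2L d0.
have [P1 dP1 P10] := poly_primitive Q.
have [P2 dP2 P20] := poly_primitive (P1 + (F1 0)%:P).
pose P := P2 + (F 0)%:P.
have dP : P^`() = P1 + (F1 0)%:P by rewrite /P derivD derivC addr0.
have ddP : P^`()^`() = Q by rewrite dP derivD derivC addr0.
have H2 p : 0 <= p -> `|F2 p - P^`()^`().[p]| <= d * weight b n p.
  by move=> p0; have := HQ (Num.sqrt p); rewrite sqr_sqrtr// ddP.
have b0' := ltW b0.
have Wm p r c m : 0 <= c -> 0 <= r <= p -> weight c m r <= weight c m p.
  by move=> c0 rp; rewrite weight_homo// lexx c0.
have mvt (E E1 : R -> R) c m : 0 < c -> halfline_C1 E E1 -> E 0 = 0 ->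
    (forall p, 0 <= p -> `|E1 p| <= d * weight c m p) ->
    forall p, 0 <= p -> `|E p| <= d * (p * weight c m p).
  move=> c0 dE E0 HE p p0.
  rewrite -[E p]subr0 -E0 (le_trans (halfline_mean_value dE p0 (lexx 0)
    (M := d * weight c m p) _))//.
    move=> r; rewrite (min_idPr p0) (max_idPl p0) => /andP[r0 rp]; apply: le_trans (HE _ r0) _.
    by rewrite ler_pM2l// Wm ?r0// ltW.
  by rewrite subr0 ger0_norm// [p * _]mulrC mulrA.
have H1 p : 0 <= p -> `|F1 p - P^`().[p]| <= d * (b^-1 * weight (4 * b) n.+1 p).
  move=> p0; apply: le_trans (mvt (fun x => F1 x - P^`().[x]) _ _ _ b0 _ _ H2 _ p0) _.
  - exact: halfline_C1B dF1 (halfline_C1_horner _).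
  - by rewrite dP hornerD hornerC P10 add0r subrr.
  - by rewrite ler_pM2l// mul_weight_le.
have H0 p : 0 <= p ->
    `|F p - P.[p]| <= d * (b^-1 * ((4 * b)^-1 * weight (16 * b) n.+2 p)).
  move=> p0.
  (* The factor [b] cancels the [b^-1] of [H1], so that the derivative is again bounded by [d] times
     a weight, as [mvt] requires. *)
  pose E x := b * (F x - P.[x]); pose E1 x := b * (F1 x - P^`().[x]).
  have HE : forall p, 0 <= p -> `|E1 p| <= d * weight (4 * b) n.+1 p.
    move=> r r0; rewrite /E1 normrM gtr0_norm// mulrC -ler_pdivlMr//.
    by rewrite -mulrA [_ / b]mulrC H1.
  have := mvt E E1 _ _ bb0 _ _ HE p p0.
  rewrite {1}/E normrM gtr0_norm// => H.
  have {}H : b * `|F p - P.[p]| <= d * (p * weight (4 * b) n.+1 p).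
    apply: H; last by rewrite /E /P hornerD hornerC P20 add0r subrr mulr0.
    have [dE cE] := halfline_C1B dF (halfline_C1_horner P).
    split=> [x x0|u v u0]; first by have := dE _ x0 => ?; exact: is_deriveZ.
    by move=> x; apply: cvgMr; exact: cE.
  rewrite -[X in _ <= _ * X]mulrC mulrA -ler_pdivrMr ?invr_gt0// invrK mulrC.
  apply: le_trans H _; rewrite ler_pM2l//.
  have := @mul_weight_le _ (4 * b) n.+1 p bb0 p0.
  by rewrite mulrA -natrM.
have dC : d * C = e by rewrite divfK// gt_eqF.
exists P, n.+2 => p p0.
have W0 : 0 <= weight (16 * b) n.+2 p by rewrite weight_ge0// mulr_ge0.
have W1 : weight b n p <= weight (16 * b) n.+2 p.
  by rewrite weight_homo ?lexx ?b0' ?p0 ?(leq_trans (leqnSn _) (leqnSn _))//= ler_peMl// ler1n.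
have W2 : weight (4 * b) n.+1 p <= weight (16 * b) n.+2 p.
  by rewrite weight_homo ?lexx ?p0 ?mulr_ge0 ?leqnSn//= ler_pM2r// ler_nat.
have Ci (x : R) : 0 <= x -> x <= C ->
    d * (x * weight (16 * b) n.+2 p) <= e * weight (16 * b) n.+2 p.
  by move=> x0 xC; rewrite -dC -mulrA ler_pM2l// ler_wpM2r.
have bi : 0 <= b^-1 by rewrite invr_ge0.
have bbi : 0 <= (4 * b)^-1 by rewrite invr_ge0 ltW.
have bbb := mulr_ge0 bi bbi.
split.
- by apply: le_trans (H0 _ p0) _; rewrite [b^-1 * _]mulrA Ci// /C; lra.
- apply: le_trans (H1 _ p0) _; apply: le_trans (Ci b^-1 bi _); last by rewrite /C; lra.
  by rewrite ler_pM2l// ler_wpM2l.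
- apply: le_trans (H2 _ p0) _; apply: le_trans (Ci 1 ler01 _); last by rewrite /C; lra.
  by rewrite mul1r ler_pM2l.
Qed.

(* The kernels of a function [F] of [p = x ^ 2] with derivatives [F1], [F2]:
   [S] is its divided difference at [p, q] and [N] the derivative of
   [p * S p q] in [p]; the last two clauses are the diagonal values. *)
Definition difference_kernels (R : realType) (F F1 F2 : R -> R)
    (S N : R -> R -> R) : Prop :=
  forall p q : R, 0 <= p -> 0 <= q ->
    [/\ (p - q) * S p q = F p - F q, (p - q) * N p q = p * F1 p - q * S p q,
        S p p = F1 p & 2 * N p p = 2 * F1 p + p * F2 p].

(** To be applied to [F - P]: the smallness of the first two derivatives passes to both kernels,
    with no division by [p - q] left. Since [B] is nondecreasing, [B p + B q] dominates it on the
    segment between [p] and [q]. *)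
Lemma difference_kernels_bound (R : realType) (F F1 F2 B : R -> R)
    (S N : R -> R -> R) :
    difference_kernels F F1 F2 S N -> halfline_C1 F F1 -> halfline_C1 F1 F2 ->
    (forall p, 0 <= p -> `|F1 p| <= B p) ->
    (forall p, 0 <= p -> `|F2 p| <= B p) ->
    (forall p q, 0 <= p -> p <= q -> B p <= B q) ->
  forall p q, 0 <= p -> 0 <= q ->
    `|S p q| <= B p + B q /\ `|N p q| <= (1 + q) * (B p + B q).
Proof.
move=> K dF dF1 F1B F2B Bm p q p0 q0.
have B0 r : 0 <= r -> 0 <= B r by move=> r0; rewrite (le_trans _ (F1B _ r0)).
have Bp := B0 _ p0; have Bq := B0 _ q0.
have Bmax r : Num.min p q <= r <= Num.max p q -> 0 <= r /\ B r <= B p + B q.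
  move=> /andP[]; rewrite ge_min le_max => r0 rm.
  have {}r0 : 0 <= r by case/orP: r0; exact: le_trans.
  split=> //; case/orP: rm => rm.
    by rewrite (le_trans (Bm _ _ r0 rm))// lerDl.
  by rewrite (le_trans (Bm _ _ r0 rm))// lerDr.
have [KS KN KSd KNd] := K p q p0 q0.
have [pq|pq] := eqVneq p q.
  rewrite -{}pq in KS KN KSd KNd *; rewrite KSd; split.
    by rewrite (le_trans (F1B _ p0))// lerDl.
  have -> : N p p = F1 p + p * (F2 p / 2).
    by apply: (mulfI (_ : 2 != 0 :> R)) => //; rewrite KNd; field.
  rewrite (le_trans (ler_normD _ _))// (mulrDl 1) mul1r lerD//.
    by rewrite (le_trans (F1B _ p0))// lerDl.
  rewrite normrM (ger0_norm p0) ler_wpM2l// normrM normfV (@ger0_norm _ 2)//.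
  by have := F2B _ p0; lra.
have pq0 : 0 < `|p - q| by rewrite normr_gt0 subr_eq0.
have SB : `|S p q| <= B p + B q.
  rewrite -(ler_pM2l pq0) -normrM KS mulrC.
  by apply: (halfline_mean_value dF p0 q0) => r /Bmax[r0]; exact/le_trans/F1B.
split=> //.
(* [E p - E q = (p - q) * (S p q - F1 p)], and the derivative [F1 r - F1 p] is in turn small by the
   bound on [F2]; hence [F1 p - S p q] is of order [|p - q|], which compensates the denominator in
   [N p q = F1 p + q * (F1 p - S p q) / (p - q)]. *)
pose E r := F r - F1 p * r.
have dE : halfline_C1 E (fun r => F1 r - F1 p).
  have := halfline_C1B dF (halfline_C1_horner (F1 p *: 'X)).
  rewrite derivZ derivX alg_polyC.
  have -> : horner (F1 p)%:P = (fun=> F1 p) by apply/funext => r; rewrite hornerC.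
  by rewrite /E; under eq_fun do rewrite hornerZ hornerX.
have T : `|F1 p - S p q| <= (B p + B q) * `|p - q|.
  rewrite -(ler_pM2l pq0) -normrM mulrBr KS.
  have -> : (p - q) * F1 p - (F p - F q) = - (E p - E q) by rewrite /E; ring.
  rewrite normrN mulrC.
  apply: (halfline_mean_value dE p0 q0) => r rpq; have [r0 Br] := Bmax _ rpq.
  have rp : Num.min p q <= Num.min r p /\ Num.max r p <= Num.max p q /\ `|r - p| <= `|p - q|.
    have [[pr rq]|[qr rp]] : (p <= r /\ r <= q) \/ (q <= r /\ r <= p).
    - by case/andP: rpq; case: (lerP p q) => _ ? ?; [left|right].
    - have pq' := le_trans pr rq.
      rewrite (min_idPl pq') (max_idPr pq') (min_idPr pr) (max_idPl pr) lexx rq.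
      split=> //; split=> //; rewrite ger0_norm ?subr_ge0// distrC.
      by rewrite ger0_norm ?subr_ge0// lerD2r.
    - have qp := le_trans qr rp.
      rewrite (min_idPr qp) (max_idPl qp) (min_idPl rp) (max_idPr rp) lexx qr.
      split=> //; split=> //; rewrite distrC ger0_norm ?subr_ge0//.
      by rewrite ger0_norm ?subr_ge0// lerD2l lerN2.
  case: rp => rp1 [rp2 rp3].
  apply: le_trans (halfline_mean_value (M := B p + B q) dF1 r0 p0 _) _.
    move=> s /andP[s1 s2]; have [|s0] := Bmax s; last exact/le_trans/F2B.
    by rewrite (le_trans rp1 s1) (le_trans s2 rp2).
  by rewrite ler_wpM2l// addr_ge0.
have -> : N p q = F1 p + q * ((F1 p - S p q) / (p - q)).
  apply: (mulfI (_ : p - q != 0)); first by rewrite subr_eq0.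
  by rewrite KN; field; rewrite subr_eq0.
rewrite (le_trans (ler_normD _ _))// (mulrDl 1) mul1r lerD//.
  by rewrite (le_trans (F1B _ p0))// lerDl.
by rewrite normrM (ger0_norm q0) ler_wpM2l// normrM normfV ler_pdivrMr.
Qed.

(* Written so that integrating [x ^ s * S (x ^ 2) (y ^ 2)] in [x] and [y] yields
   the convolutions of moments of [moment_rate]. *)
Definition poly_S (R : realType) (P : {poly R}) (p q : R) : R :=
  \sum_(i < size P) P`_i * \sum_(h < i) q ^+ h * p ^+ (i - h.+1).

Definition poly_N (R : realType) (P : {poly R}) (p q : R) : R :=
  \sum_(i < size P) P`_i * \sum_(h < i) (i - h)%:R * (q ^+ h * p ^+ (i - h.+1)).

Lemma horner_deriv_sum (R : realType) (P : {poly R}) (x : R) :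
  P^`().[x] = \sum_(i < size P) P`_i * (i%:R * x ^+ i.-1).
Proof.
rewrite -{1}[P]coefK poly_def raddf_sum horner_sum; apply: eq_bigr => i _ /=.
by rewrite derivZ derivXn hornerZ hornerMn hornerXn mulr_natl.
Qed.

Lemma horner_deriv2_sum (R : realType) (P : {poly R}) (x : R) :
  P^`()^`().[x] = \sum_(i < size P) P`_i * (i%:R * i.-1%:R * x ^+ i.-2).
Proof.
rewrite -{1}[P]coefK poly_def !raddf_sum horner_sum; apply: eq_bigr => i _ /=.
rewrite derivZ derivXn derivZ derivMn derivXn hornerZ !hornerMn hornerXn.
by rewrite -mulrA !mulr_natl.
Qed.

(** By linearity it suffices to treat the monomials, whose kernels satisfy the Horner-like
    recursions [SS] and [NS]; the four identities follow from these by induction on the degree or,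
    for the diagonal of [S], by direct evaluation. *)
Lemma poly_difference_kernels (R : realType) (P : {poly R}) :
  difference_kernels (horner P) (horner P^`()) (horner P^`()^`())
    (poly_S P) (poly_N P).
Proof.
move=> p q _ _.
pose S i : R := \sum_(h < i) q ^+ h * p ^+ (i - h.+1).
pose N r i : R := \sum_(h < i) (i - h)%:R * (r ^+ h * p ^+ (i - h.+1)).
have SS i : S i.+1 = p ^+ i + q * S i.
  rewrite /S big_ord_recl /= expr0 mul1r subSS subn0; congr (_ + _).
  by rewrite mulr_sumr; apply: eq_bigr => h _; rewrite /bump /= add1n subSS exprS mulrA.
have NS r i : N r i.+1 = i.+1%:R * p ^+ i + r * N r i.
  rewrite /N big_ord_recl /= expr0 mul1r subSS !subn0; congr (_ + _).
  rewrite mulr_sumr; apply: eq_bigr => h _.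
  by rewrite /bump /= add1n !subSS exprS -mulrA mulrCA.
have S0 : S 0%N = 0 by rewrite /S big_ord0.
have N0 r : N r 0%N = 0 by rewrite /N big_ord0.
have HS i : (p - q) * S i = p ^+ i - q ^+ i.
  elim: i => [|i IH]; first by rewrite S0 mulr0 subrr.
  by rewrite SS mulrDr mulrCA IH !exprS; ring.
have HN i : (p - q) * N q i = i%:R * p ^+ i - q * S i.
  elim: i => [|i IH]; first by rewrite S0 N0 !mulr0 mul0r subrr.
  by rewrite NS mulrDr [_ * (q * _)]mulrCA IH SS -natr1 !exprS; ring.
split.
- rewrite !horner_coef /poly_S mulr_sumr -sumrB; apply: eq_bigr => i _.
  by rewrite mulrCA HS mulrBr.
- rewrite /poly_N /poly_S horner_deriv_sum !mulr_sumr -sumrB; apply: eq_bigr => i _.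
  rewrite mulrCA HN mulrBr; congr (_ - _); last by rewrite mulrCA.
  case: (nat_of_ord i) => [|j]; first by rewrite !mul0r !mulr0.
  by rewrite exprS /=; ring.
- rewrite /poly_S horner_deriv_sum; apply: eq_bigr => i _; congr (_ * _).
  rewrite (eq_bigr (fun=> p ^+ i.-1)) => [|h _].
    by rewrite sumr_const card_ord mulr_natl.
  by rewrite -exprD; congr (_ ^+ _); have := ltn_ord h; lia.
- rewrite /poly_N horner_deriv_sum horner_deriv2_sum !mulr_sumr -big_split/=.
  apply: eq_bigr => i _; rewrite mulrCA [2 * (_ * _)]mulrCA [p * _]mulrCA -mulrDr.
  congr (_ * _); rewrite -/(N p i).
  have -> : 2 * N p i = i%:R * i.+1%:R * p ^+ i.-1.
    elim: (nat_of_ord i) => [|[|j] IH]; first by rewrite N0 mulr0 !mul0r.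
      by rewrite NS N0 mulr0 addr0 expr0 !mulr1 mul1r.
    by rewrite NS mulrDr [2 * (p * _)]mulrCA IH /= !exprS; ring.
  case: (nat_of_ord i) => [|[|j]]; rewrite /= ?mul0r ?mulr0 ?addr0 ?expr0//; first by ring.
  by rewrite exprS -!natr1; ring.
Qed.

(** * Moments as functions of time: polynomiality, growth, limits of derivatives *)

(** The moment recursion determines [c l t] only for [t >= 0], so agreement with a polynomial is
    claimed only there. *)
Definition halfline_poly (R : realType) (f : R -> R) : Prop :=
  exists q : {poly R}, forall t : R, 0 <= t -> f t = q.[t].

Lemma halfline_polyD (R : realType) (f g : R -> R) :
  halfline_poly f -> halfline_poly g -> halfline_poly (fun t => f t + g t).
Proof.
move=> [p fp] [q gq]; exists (p + q) => t t0.
by rewrite hornerD fp// gq.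
Qed.

Lemma halfline_polyM (R : realType) (f g : R -> R) :
  halfline_poly f -> halfline_poly g -> halfline_poly (fun t => f t * g t).
Proof.
move=> [p fp] [q gq]; exists (p * q) => t t0.
by rewrite hornerM fp// gq.
Qed.

Lemma halfline_poly_cst (R : realType) (a : R) : halfline_poly (fun=> a).
Proof. by exists a%:P => t _; rewrite hornerC. Qed.

Lemma halfline_poly_sum (R : realType) (n : nat) (f : nat -> R -> R) :
  (forall i, (i < n)%N -> halfline_poly (f i)) ->
  halfline_poly (fun t => \sum_(0 <= i < n) f i t).
Proof.
elim: n => [_|n IH H].
  by exists 0 => t _; rewrite horner0 big_nil.
have [|p fp] := IH; first by move=> i /ltnW; exact: H.
have [q fq] := H n (ltnSn n).
by exists (p + q) => t t0; rewrite big_nat_recr//= hornerD fp// fq.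
Qed.

Lemma Rintegral_halfline_poly (R : realType) (f : R -> R) :
  halfline_poly f -> exists P : {poly R}, forall t : R, 0 <= t ->
    \int[lebesgue_measure]_(s in `[0, t]) f s = P.[t] /\ P^`().[t] = f t.
Proof.
move=> [q fq]; have [P dP P0] := poly_primitive q.
exists P => t t0; rewrite dP fq//; split=> //.
have -> : \int[lebesgue_measure]_(s in `[0, t]) f s =
    \int[lebesgue_measure]_(s in `[0, t]) (horner q s).
  by apply: eq_Rintegral => s; rewrite inE/= in_itv/= => /andP[s0 _]; rewrite fq.
(* The fundamental theorem is applied on a nondegenerate interval, so [t = 0] is treated apart;
   there both sides vanish. *)
move: t0; rewrite le_eqVlt => /predU1P[<-|t0].
  by rewrite set_itv1 Rintegral_set1 P0.
rewrite /Rintegral (@continuous_FTC2 _ _ (horner P))//.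
- by rewrite P0 sube0.
- apply: continuous_subspaceT => x.
  exact/differentiable_continuous/derivable1_diffP/derivable_horner.
- have cP : continuous (horner P).
    by move=> x; apply/differentiable_continuous/derivable1_diffP/derivable_horner.
  split; first by move=> x _; exact: derivable_horner.
    exact/cvg_at_right_filter/cP.
  exact/cvg_at_left_filter/cP.
- by move=> x _; rewrite derive1E derive_val dP.
Qed.

(* The time derivative of [c (2 l)] and [c (2 l + 1)] prescribed by the moment
   recursion; [s] is the parity, and the even case is symmetrised so that both
   parities are expressed with the weights [l - h]. *)
Definition moment_rate (R : realType) (nu0 : R) (c : nat -> R -> R) (s : bool)
    (l : nat) (t : R) : R :=
  2 * nu0 * (l%:R * c (2 * l.-1 + s)%N t) +
  4 * (\sum_(h < l) (l - h)%:R * (c (2 * h)%N t * c (2 * (l - h.+1) + s)%N t)) -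
  (if s then 0 else 2) * \sum_(h < l) (c (2 * h)%N t * c (2 * (l - h.+1) + s)%N t).

(** Reversing the sum exchanges the two factors and turns the weight [l - h] into [h + 1]; the two
    weights add up to [l + 1]. *)
Lemma sum_weight_symmetric (R : realType) (a : nat -> R) (l : nat) :
  2 * \sum_(h < l) (l - h)%:R * (a h * a (l - h.+1)%N) =
  l.+1%:R * \sum_(h < l) a h * a (l - h.+1)%N.
Proof.
rewrite mulr2n mulrDl mul1r {1}(reindex_inj rev_ord_inj) /= -big_split mulr_sumr /=.
apply: eq_bigr => h _; have hl := ltn_ord h.
have -> : (l - (l - h.+1).+1 = h)%N by lia.
rewrite [a (l - _)%N * _]mulrC -mulrDl -natrD; congr (_%:R * _).
lia.
Qed.

Section moments.
Variables (R : realType) (nu0 : R) (c : nat -> R -> R).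
Hypothesis c_zero : forall t : R, 0 <= t -> c 0%N t = 1.
Hypothesis c_one : forall t : R, 0 <= t -> c 1%N t = c 1%N 0.
Hypothesis c_even : forall (l : nat) (t : R), (1 <= l)%N -> 0 <= t ->
  c (2 * l)%N t = c (2 * l)%N 0 +
    (2 * l)%:R * \int[lebesgue_measure]_(s in `[0, t])
      (nu0 * c (2 * l - 2)%N s +
       \sum_(0 <= h < l) c (2 * h)%N s * c (2 * l - 2 * h - 2)%N s).
Hypothesis c_odd : forall (l : nat) (t : R), (1 <= l)%N -> 0 <= t ->
  c (2 * l + 1)%N t = c (2 * l + 1)%N 0 +
    \int[lebesgue_measure]_(s in `[0, t])
      ((2 * l)%:R * nu0 * c (2 * l - 1)%N s +
       4 * \sum_(0 <= h < l)
             (l - h)%:R * c (2 * h)%N s * c (2 * l - 2 * h - 1)%N s).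

(** The integrands for [c (2 l)] and [c (2 l + 1)] involve only indices below [2 l], so strong
    induction on [l] treats both parities at once and turns the integral recursion into a
    differential one. *)
Lemma moment_poly (l : nat) (s : bool) : exists p : {poly R}, forall t : R, 0 <= t ->
  c (2 * l + s)%N t = p.[t] /\ p^`().[t] = moment_rate nu0 c s l t.
Proof.
elim/ltn_ind: l s => l IH s.
have cpoly k : (k < (2 * l))%N -> halfline_poly (c k).
  move=> kl; have [|p Hp] := IH k./2 _ (odd k); first lia.
  exists p => t t0; have [<- _] := Hp t t0; congr (c _ t).
  by rewrite mul2n addnC odd_double_half.
have [->|l0] := posnP l.
  rewrite muln0 add0n; case: s.
    exists (c 1%N 0)%:P => t t0; rewrite hornerC derivC horner0 c_one//; split=> //.
    by rewrite /moment_rate !big_ord0 !(mul0r, mulr0) addr0 subr0.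
  exists 1%:P => t t0; rewrite hornerC derivC horner0 c_zero//; split=> //.
  by rewrite /moment_rate !big_ord0 !(mul0r, mulr0) addr0 subr0.
case: s.
- have [|P HP] := @Rintegral_halfline_poly R (fun s => (2 * l)%:R * nu0 * c (2 * l - 1)%N s +
       4 * \sum_(0 <= h < l)
             (l - h)%:R * c (2 * h)%N s * c (2 * l - 2 * h - 1)%N s).
    apply: halfline_polyD.
      by apply: halfline_polyM; [exact: halfline_poly_cst|apply: cpoly; lia].
    apply: halfline_polyM; first exact: halfline_poly_cst.
    apply: (@halfline_poly_sum _ _ (fun h s =>
      (l - h)%:R * c (2 * h)%N s * c (2 * l - 2 * h - 1)%N s)) => h hl.
    apply: halfline_polyM; last by apply: cpoly; lia.
    by apply: halfline_polyM; [exact: halfline_poly_cst|apply: cpoly; lia].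
  exists ((c (2 * l + 1)%N 0)%:P + P) => t t0; have [H1 H2] := HP t t0.
  rewrite hornerD hornerC derivD derivC add0r H2 (c_odd l0 t0) H1; split=> //.
  rewrite /moment_rate mul0r subr0 big_mkord; congr (_ + _).
    rewrite (_ : 2 * l.-1 + true = 2 * l - 1)%N; last by rewrite /=; lia.
    by rewrite natrM; ring.
  congr (4 * _); apply: eq_bigr => h _; rewrite mulrA; congr (_ * c _ t).
  by have := ltn_ord h; lia.
- have [|P HP] := @Rintegral_halfline_poly R (fun s => nu0 * c (2 * l - 2)%N s +
       \sum_(0 <= h < l) c (2 * h)%N s * c (2 * l - 2 * h - 2)%N s).
    apply: halfline_polyD.
      by apply: halfline_polyM; [exact: halfline_poly_cst|apply: cpoly; lia].
    apply: (@halfline_poly_sum _ _ (fun h s => c (2 * h)%N s * c (2 * l - 2 * h - 2)%N s)) => h hl.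
    by apply: halfline_polyM; apply: cpoly; lia.
  exists ((c (2 * l)%N 0)%:P + (2 * l)%:R *: P) => t t0; have [H1 H2] := HP t t0.
  rewrite hornerD hornerC hornerZ derivD derivC derivZ add0r hornerZ H2 addn0.
  rewrite (c_even l0 t0) H1; split=> //.
  rewrite /moment_rate big_mkord.
  under [in RHS]eq_bigr do rewrite addn0.
  under [X in _ - 2 * X]eq_bigr do rewrite addn0.
  have -> : \sum_(h < l) c (2 * h)%N t * c (2 * l - 2 * h - 2)%N t =
     \sum_(h < l) c (2 * h)%N t * c (2 * (l - h.+1))%N t.
    by apply: eq_bigr => h _; congr (_ * c _ t); have := ltn_ord h; lia.
  have := sum_weight_symmetric (fun h => c (2 * h)%N t) l.
  set u := \sum_(h < l) _; set v := \sum_(h < l) _ => uv.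
  have -> : 4 * u = 2 * (2 * u) by ring.
  rewrite uv addn0 (_ : 2 * l - 2 = 2 * l.-1)%N; last lia.
  by rewrite natrM; ring.
Qed.

Hypothesis nu0_ge0 : 0 <= nu0.

(** Each product of moments is controlled by [(2 h)! * (2 (l - h))! <= (2 l)!]; what remains is
    [nu0 + l + 1 <= (nu0 + 1) * (2 l + 1)], and [2 l + 1] is the missing factor of [(2 l + 2)!]. *)
Lemma moment_rate_bound (A t : R) (l : nat) : 0 <= A ->
    (forall h, (h <= l)%N -> `|c (2 * h)%N t| <= A ^+ h * (2 * h)`!%:R) ->
  `|moment_rate nu0 c false l.+1 t| <=
    (nu0 + 1) * A ^+ l * (2 * l.+1)`!%:R.
Proof.
move=> A0 Hc.
have -> : moment_rate nu0 c false l.+1 t = 2 * l.+1%:R *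
    (nu0 * c (2 * l)%N t + \sum_(h < l.+1) c (2 * h)%N t * c (2 * (l.+1 - h.+1))%N t).
  rewrite /moment_rate addn0.
  under [in X in 4 * X]eq_bigr do rewrite addn0.
  under [X in _ - 2 * X]eq_bigr do rewrite addn0.
  have := sum_weight_symmetric (fun h => c (2 * h)%N t) l.+1.
  set u := \sum_(h < l.+1) _; set v := \sum_(h < l.+1) _ => uv.
  have -> : 4 * u = 2 * (2 * u) by ring.
  by rewrite uv; ring.
rewrite normrM ger0_norm ?mulr_ge0//.
have B : `|nu0 * c (2 * l)%N t + \sum_(h < l.+1) c (2 * h)%N t * c (2 * (l.+1 - h.+1))%N t|
    <= (nu0 + l.+1%:R) * (A ^+ l * (2 * l)`!%:R).
  rewrite (le_trans (ler_normD _ _))// mulrDl lerD//.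
    by rewrite normrM ger0_norm// ler_wpM2l// Hc.
  rewrite (le_trans (ler_norm_sum _ _ _))//.
  rewrite -[l.+1 in leRHS]card_ord mulr_natl -sumr_const; apply: ler_sum => h _.
  have hl : (h <= l)%N by rewrite -ltnS.
  have hl' : (l.+1 - h.+1 <= l)%N by rewrite subSS leq_subr.
  rewrite normrM (le_trans (ler_pM _ _ (Hc _ hl) (Hc _ hl')))//.
  rewrite mulrACA -exprD subSS subnKC// ler_wpM2l ?exprn_ge0//.
  by rewrite -natrM ler_nat (leq_trans (fact_add_le _ _))// -mulnDr subnKC.
rewrite (le_trans (ler_wpM2l _ B)) ?mulr_ge0//.
have -> : (2 * l.+1)`!%:R = 2 * l.+1%:R * ((2 * l.+1%:R - 1) * (2 * l)`!%:R) :> R.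
  rewrite (_ : 2 * l.+1 = (2 * l).+2)%N ?factS ?natrM; last by lia.
  by rewrite -[(2 * l).+2%:R]natr1 -[(2 * l).+1%:R]natr1 natrM -natr1; ring.
rewrite [leRHS]mulrCA ler_wpM2l ?mulr_ge0//.
rewrite mulrCA [leRHS]mulrACA [(nu0 + 1) * _]mulrC [leRHS]mulrCA.
rewrite ler_wpM2l ?exprn_ge0// ler_wpM2r//.
have : 0 <= nu0 * l%:R by rewrite mulr_ge0.
by have : 0 <= l%:R :> R by []; rewrite -natr1; nra.
Qed.

Hypothesis c_growth : exists2 K : R, 0 < K &
  forall l : nat, `|c l 0| <= (K * l%:R) ^+ l.

Lemma moment_growth (T : R) : 0 <= T -> exists2 A : R, 0 < A &
  forall (l : nat) (t : R), 0 <= t <= T ->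
    `|c (2 * l)%N t| <= A ^+ l * (2 * l)`!%:R.
Proof.
move=> T0; have [K K0 HK] := c_growth.
(* [B] governs the initial moments: [(K * 2 l) ^ (2 l) <= K ^ (2 l) * 4 ^ (2 l) * (2 l)!]. Then [A]
   is large enough that [B + T * (nu0 + 1) <= A], which closes the induction after integrating the
   rate over [[0, T]]. *)
pose B := 16 * K ^+ 2; have B0 : 0 < B by rewrite mulr_gt0 ?exprn_gt0.
pose A := 2 * B + 2 * T * (nu0 + 1).
have TN : 0 <= T * (nu0 + 1) by rewrite mulr_ge0 ?addr_ge0.
have A0 : 0 < A by rewrite ltr_pwDl ?mulr_gt0// -mulrA mulr_ge0.
exists A => //; elim/ltn_ind => l IH t /andP[t0 tT].
case: l IH => [|l] IH; first by rewrite muln0 c_zero// normr1 fact0 mulr1.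
have init : `|c (2 * l.+1)%N 0| <= B ^+ l.+1 * (2 * l.+1)`!%:R.
  rewrite (le_trans (HK _))// exprMn.
  have -> : B ^+ l.+1 = K ^+ (2 * l.+1) * 4 ^+ (2 * l.+1).
    by rewrite /B !exprM -exprMn mulrC -natrX.
  rewrite -mulrA ler_wpM2l ?exprn_ge0 ?(ltW K0)//.
  by rewrite -!natrX -natrM ler_nat expn_self_le.
have [p Hp] := moment_poly l.+1 false; rewrite !addn0 in Hp.
have [cp _] := Hp t t0; have [cp0 _] := Hp 0 (lexx 0).
have mv : `|p.[t] - p.[0]| <= (nu0 + 1) * A ^+ l * (2 * l.+1)`!%:R * t.
  rewrite -[X in _ * X](subr0 t).
  apply: (@mean_value_bound _ (horner p) (horner p^`()) 0 t) => //.
    by have [_] := halfline_C1_horner p; apply.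
  move=> x; rewrite in_itv/= => /andP[x0 xt].
  have [_ ->] := Hp _ (ltW x0); apply: moment_rate_bound; first exact: ltW.
  by move=> h hl; apply: IH; rewrite ?ltnS// (ltW x0) (le_trans (ltW xt)).
rewrite cp -(subrK p.[0] p.[t]) (le_trans (ler_normD _ _))//.
rewrite cp0 in init; apply: le_trans (lerD mv init) _.
have f0 : 0 < (2 * l.+1)`!%:R :> R by rewrite ltr0n fact_gt0.
rewrite mulrAC -mulrDl ler_pM2r//.
have BA : B ^+ l.+1 <= A ^+ l * B.
  by rewrite exprSr ler_pM2r// lerXn2r ?nnegrE ?(ltW A0) ?(ltW B0)// /A; nra.
rewrite (le_trans (lerD (lexx _) BA))// mulrAC mulrC -mulrDr exprSr.
rewrite ler_wpM2l ?exprn_ge0 ?(ltW A0)// /A.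
have N1 : 0 <= nu0 + 1 by rewrite addr_ge0.
have := ler_wpM2l N1 tT; nra.
Qed.

End moments.

(* Two approximants of [g] have close derivatives, so their difference is Lipschitz
   with a small constant; letting one of them tend to [g] bounds the difference
   quotients of [g] minus the other one. *)
Lemma uniform_limit_derivative (R : realType) (g lam : R -> R) (t : R) : 0 <= t ->
    (forall e : R, 0 < e -> exists p : {poly R}, forall s : R, 0 <= s <= t + 1 ->
       `|g s - p.[s]| <= e /\ `|lam s - p^`().[s]| <= e) ->
  (s - t)^-1 * (g s - g t) @[s --> within (fun s : R => 0 <= s) t^'] --> lam t.
Proof.
move=> t0 H; apply/cvgrPdist_le => /= e0 e00.
pose e := e0 / 5; have e_gt0 : 0 < e by rewrite divr_gt0.
have [p Hp] := H _ e_gt0.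
have tt : 0 <= t <= t + 1 by rewrite t0/= lerDl.
have : continuous (horner p^`()).
  by move=> x; apply/differentiable_continuous/derivable1_diffP/derivable_horner.
move=> /(_ t) /cvgrPdist_le /(_ _ e_gt0) /nbhs_ballP[d /= d0 Hd].
have near_dist (r : R) : 0 < r -> \forall s \near t^', `|t - s| < r.
  move=> r0; apply: nbhs_dnbhs; apply/nbhs_ballP; exists r => //.
rewrite near_withinE; near=> s => s0.
have st : s != t by near: s; exact: nbhs_dnbhs_neq.
have sd : `|t - s| < d by near: s; exact: near_dist.
have s1 : `|t - s| < 1 by near: s; exact: near_dist.
have u0 : 0 < `|s - t| by rewrite normr_gt0 subr_eq0.
have sT : 0 <= s <= t + 1.
  by rewrite s0/=; move: s1; rewrite ltr_norml => /andP[? ?]; lra.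
(* The second approximant is chosen after [s], with accuracy proportional to [|s - t|], so that
   replacing [g] by it survives the division by [s - t]. Five errors of size [e] result, whence
   [e0 / 5]. *)
pose e' := e * `|s - t| / 2; have e'0 : 0 < e' by rewrite divr_gt0 ?mulr_gt0.
have [p2 Hp2] := H _ e'0.
have between r : Num.min s t <= r <= Num.max s t -> 0 <= r <= t + 1 /\ `|t - r| <= `|t - s|.
  have [st'|/ltW ts'] := leP s t => /andP[r1 r2].
    split; first by apply/andP; split; lra.
    by rewrite !ger0_norm ?subr_ge0// lerD2l lerN2.
  split; first by case/andP: sT => *; apply/andP; split; lra.
  by rewrite distrC [`|t - s|]distrC !ger0_norm ?subr_ge0// lerD2r.
have e'e : e' <= e.
  rewrite /e' distrC -mulrA ler_piMr ?(ltW e_gt0)//.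
  by rewrite ler_pdivrMr// mul1r (le_trans (ltW s1))// ler1n.
have A1 : `|(p.[s] - p2.[s]) - (p.[t] - p2.[t])| <= (e + e') * `|s - t|.
  apply: (halfline_mean_value (halfline_C1B (halfline_C1_horner p) (halfline_C1_horner p2))) => //.
  move=> r /between[rT _]; have [_ H1] := Hp r rT; have [_ H2] := Hp2 r rT.
  rewrite -(subrK (lam r) p^`().[r]) -addrA (le_trans (ler_normD _ _))// lerD//.
  by rewrite distrC.
have A2 : `|p.[s] - p.[t] - p^`().[t] * (s - t)| <= e * `|s - t|.
  have -> : p.[s] - p.[t] - p^`().[t] * (s - t) =
    (p.[s] - (p^`().[t] *: 'X).[s]) - (p.[t] - (p^`().[t] *: 'X).[t]).
    by rewrite !hornerZ !hornerX; ring.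
  apply: (halfline_mean_value (halfline_C1B (halfline_C1_horner p) (halfline_C1_horner _))) => //.
  move=> r /between[_ rs]; rewrite derivZ derivX alg_polyC hornerC distrC.
  by apply: Hd; rewrite /ball /= (le_lt_trans rs).
have [Hs _] := Hp2 s sT; have [Ht _] := Hp2 t tt.
have [_ Hl] := Hp t tt.
have -> : lam t - (s - t)^-1 * (g s - g t) =
   (s - t)^-1 * (lam t * (s - t) - (g s - g t)) by field; rewrite subr_eq0.
rewrite normrM normfV ler_pdivrMl//.
have -> : lam t * (s - t) - (g s - g t) = (lam t - p^`().[t]) * (s - t)
   - (p.[s] - p.[t] - p^`().[t] * (s - t))
   + ((p.[s] - p2.[s]) - (p.[t] - p2.[t])) - (g s - p2.[s]) + (g t - p2.[t]) by ring.
have L0 : `|(lam t - p^`().[t]) * (s - t)| <= e * `|s - t| by rewrite normrM ler_wpM2r.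
have E' : e' + e' = e * `|s - t| by rewrite /e'; field.
have EE : e0 = 5 * e by rewrite /e; field.
have e's : e' * `|s - t| <= e * `|s - t| by rewrite ler_wpM2r.
have tri (a1 a2 a3 a4 a5 : R) :
    `|a1 - a2 + a3 - a4 + a5| <= `|a1| + `|a2| + `|a3| + `|a4| + `|a5|.
  do 4 (apply: le_trans (ler_normD _ _) _; rewrite ?normrN lerD2r).
  by rewrite lexx.
apply: le_trans (tri _ _ _ _ _) _.
move: L0 A1 A2 Hs Ht; rewrite EE mulrDl; lra.
Unshelve. all: by end_near. Qed.

(** * Functions of polynomial growth and their expectations *)

Lemma norm_expr_bool_le (R : realDomainType) (x : R) (s : bool) :
  `|x ^+ s| <= 1 + x ^+ 2.
Proof.
case: s => /=; last by rewrite expr0 normr1 lerDl sqr_ge0.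
have := sqr_ge0 (`|x| - 1); rewrite expr1 sqrrB real_normK ?num_real//.
by have := sqr_ge0 x; rewrite mulr1 expr1n mulr2n; lra.
Qed.

(** Continuity provides measurability and polynomial growth provides integrability against any law
    with all moments, so linearity and monotonicity of integrals reduce to closure properties of
    this class. *)
Definition moderate (R : realType) (f : R -> R) : Prop :=
  continuous f /\
  exists2 C : R, 0 <= C & exists n : nat, forall x, `|f x| <= C * (1 + x ^+ 2) ^+ n.

Section moderate.
Variable R : realType.
Implicit Types f g : R -> R.

Let base_ge1 (x : R) : 1 <= 1 + x ^+ 2. Proof. by rewrite lerDl sqr_ge0. Qed.
Let base_ge0 (x : R) : 0 <= 1 + x ^+ 2. Proof. by rewrite addr_ge0 ?sqr_ge0. Qed.

Lemma moderateD f g : moderate f -> moderate g -> moderate (fun x => f x + g x).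
Proof.
move=> [cf [C C0 [n Hf]]] [cg [D D0 [m Hg]]]; split.
  by move=> x; apply: cvgD; [exact: cf|exact: cg].
exists (C + D); first exact: addr_ge0.
exists (n + m)%N => x; rewrite (le_trans (ler_normD _ _))// mulrDl.
apply: lerD.
  by rewrite (le_trans (Hf x))// ler_wpM2l// ler_weXn2l// leq_addr.
by rewrite (le_trans (Hg x))// ler_wpM2l// ler_weXn2l// leq_addl.
Qed.

Lemma moderateM f g : moderate f -> moderate g -> moderate (fun x => f x * g x).
Proof.
move=> [cf [C C0 [n Hf]]] [cg [D D0 [m Hg]]]; split.
  by move=> x; apply: cvgM; [exact: cf|exact: cg].
exists (C * D); first exact: mulr_ge0.
by exists (n + m)%N => x; rewrite normrM exprD mulrACA ler_pM.
Qed.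

Lemma moderate_cst (a : R) : moderate (fun=> a).
Proof.
split; first by move=> x; exact: cvg_cst.
by exists `|a| => //; exists 0%N => x; rewrite expr0 mulr1.
Qed.

Lemma moderate_id : moderate (fun x : R => x).
Proof.
split; first by move=> x; exact: cvg_id.
exists 1 => //; exists 1%N => x; rewrite mul1r expr1.
exact: (norm_expr_bool_le x true).
Qed.

Lemma eq_moderate f g : f =1 g -> moderate f -> moderate g.
Proof. by move=> /funext ->. Qed.

Lemma moderateZ (a : R) f : moderate f -> moderate (fun x => a * f x).
Proof. by move=> mf; apply: moderateM => //; exact: moderate_cst. Qed.

Lemma moderateB f g : moderate f -> moderate g -> moderate (fun x => f x - g x).
Proof.
move=> mf mg; apply: eq_moderate (moderateD mf (moderateZ (-1) mg)) => x.
by rewrite mulN1r.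
Qed.

Lemma moderateX f (n : nat) : moderate f -> moderate (fun x => f x ^+ n).
Proof.
move=> mf; elim: n => [|n IH]; first exact: (moderate_cst 1).
by apply: eq_moderate (moderateM mf IH) => x; rewrite exprS.
Qed.

Lemma moderate_sum (n : nat) (f : nat -> R -> R) :
  (forall i, moderate (f i)) -> moderate (fun x => \sum_(i < n) f i x).
Proof.
move=> mf; elim: n => [|n IH].
  by apply: eq_moderate (moderate_cst 0) => x; rewrite big_ord0.
by apply: eq_moderate (moderateD IH (mf n)) => x; rewrite big_ord_recr.
Qed.

Lemma moderate_horner (P : {poly R}) f :
  moderate f -> moderate (fun x => P.[f x]).
Proof.
move=> mf; have := moderate_sum (size P) (fun i => moderateZ P`_i (moderateX i mf)).
by apply: eq_moderate => x; rewrite horner_coef.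
Qed.

Lemma moderate_weight (b : R) (n : nat) :
  moderate (fun x => weight b n (x ^+ 2)).
Proof.
apply: (@moderate_sum n.+1 (fun k x => b ^+ k * (x ^+ 2) ^+ k / (k.*2)`!%:R)) => k.
apply: moderateM (moderate_cst _); apply: moderateZ; apply: moderateX.
exact/moderateX/moderate_id.
Qed.

End moderate.

Section expectation.
Variables (R : realType) (P : probability (measurableTypeR R) R) (m : nat -> R).
Hypothesis Pm : has_moments P m.
Implicit Types f g : R -> R.

Definition expect f : R := \int[P]_x f x.

Lemma moderate_measurable f : moderate f ->
  measurable_fun [set: measurableTypeR R] (f : measurableTypeR R -> R).
Proof. by move=> [cf _]; exact: continuous_measurable_fun. Qed.

Lemma moderate_integrable f : moderate f ->
  P.-integrable [set: measurableTypeR R] (EFin \o f).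
Proof.
move=> mf; have [_ [C C0 [n Hf]]] := mf.
have ih : forall q : {poly R}, P.-integrable [set: measurableTypeR R] (EFin \o horner q).
  move=> q; rewrite -[q]coefK poly_def; elim: (size q) => [|k IH].
    rewrite big_ord0 (_ : EFin \o _ = cst 0%E); last by apply/funext => x /=; rewrite horner0.
    exact: integrable0.
  rewrite big_ord_recr/=.
  have -> : EFin \o horner (\sum_(i < k) q`_i *: 'X^i + q`_k *: 'X^k) =
    ((EFin \o horner (\sum_(i < k) q`_i *: 'X^i)) \+ (fun x => (q`_k)%:E * (x ^+ k)%:E))%E.
    by apply/funext => x /=; rewrite hornerD hornerZ hornerXn EFinD EFinM.
  apply: integrableD => //; apply: integrableZl => //.
  by have [] := Pm k.
apply: (le_integrable _ _ _ (ih (C *: (1 + 'X^2) ^+ n))) => //.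
  by apply/measurable_EFinP; exact: moderate_measurable.
move=> x _ /=; rewrite lee_fin hornerZ horner_exp hornerD hornerC hornerXn.
by rewrite (le_trans (Hf x))// ler_norm.
Qed.

Lemma expectD f g : moderate f -> moderate g ->
  expect (fun x => f x + g x) = expect f + expect g.
Proof. by move=> mf mg; apply: RintegralD => //; exact: moderate_integrable. Qed.

Lemma expectB f g : moderate f -> moderate g ->
  expect (fun x => f x - g x) = expect f - expect g.
Proof. by move=> mf mg; apply: RintegralB => //; exact: moderate_integrable. Qed.

Lemma expectZ a f : moderate f -> expect (fun x => a * f x) = a * expect f.
Proof. by move=> mf; apply: RintegralZl => //; exact: moderate_integrable. Qed.

Lemma expectZr a f : moderate f -> expect (fun x => f x * a) = expect f * a.
Proof. by move=> mf; apply: RintegralZr => //; exact: moderate_integrable. Qed.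

Lemma expect_cst a : expect (fun=> a) = a.
Proof.
rewrite /expect Rintegral_cst//.
by rewrite [X in fine X](probability_setT P) mulr1.
Qed.

Lemma le_expect f g : moderate f -> moderate g -> (forall x, f x <= g x) ->
  expect f <= expect g.
Proof.
by move=> mf mg fg; apply: le_Rintegral => //; exact: moderate_integrable.
Qed.

Lemma norm_expect_le f g : moderate f -> moderate g ->
  (forall x, `|f x| <= g x) -> `|expect f| <= expect g.
Proof.
move=> mf mg fg; rewrite ler_norml -mulN1r -expectZ//; apply/andP; split.
  apply: le_expect => // [|x]; first exact: moderateZ.
  by rewrite mulN1r; have := fg x; rewrite ler_norml => /andP[].
by apply: le_expect => // x; rewrite (le_trans (ler_norm _)).
Qed.

Lemma expect_sum (n : nat) (f : nat -> R -> R) : (forall i, moderate (f i)) ->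
  expect (fun x => \sum_(i < n) f i x) = \sum_(i < n) expect (f i).
Proof.
move=> mf; elim: n => [|n IH].
  by under eq_fun do rewrite big_ord0; rewrite big_ord0 expect_cst.
under eq_fun do rewrite big_ord_recr/=.
by rewrite expectD// ?IH ?big_ord_recr//; exact: moderate_sum.
Qed.

Lemma expect_monomial (l : nat) : expect (fun x => x ^+ l) = m l.
Proof. by have [] := Pm l. Qed.

(** The factorials cancel: the term of index [k] is at most [(b * A) ^ k <= 2 ^ - k], and the
    geometric sum is bounded independently of [n]. *)
Lemma expect_weight_le2 (A b : R) (n : nat) : 0 <= b -> 0 <= A -> b * A <= 2^-1 ->
    (forall l, `|m (2 * l)%N| <= A ^+ l * (2 * l)`!%:R) ->
  expect (fun x => weight b n (x ^+ 2)) <= 2.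
Proof.
move=> b0 A0 bA HA; rewrite /weight.
rewrite (expect_sum n.+1 (f := fun k x => b ^+ k * (x ^+ 2) ^+ k / (k.*2)`!%:R)); last first.
  move=> k; apply: moderateM (moderate_cst _); apply: moderateZ; apply: moderateX.
  exact/moderateX/moderate_id.
have geo : \sum_(k < n.+1) (2^-1 : R) ^+ k <= 2.
  have -> : \sum_(k < n.+1) (2^-1 : R) ^+ k = 2 - 2^-1 ^+ n.
    elim: n => [|k IH]; first by rewrite big_ord1 !expr0; ring.
    by rewrite big_ord_recr/= IH exprS; field.
  by rewrite gerBl exprn_ge0// invr_ge0.
apply: le_trans geo; apply: ler_sum => k _.
have mX : moderate (fun x : R => x ^+ (2 * k)) by exact/moderateX/moderate_id.
have -> : expect (fun x => b ^+ k * (x ^+ 2) ^+ k / (k.*2)`!%:R) =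
    b ^+ k * m (2 * k)%N / (k.*2)`!%:R.
  under eq_fun do rewrite -exprM.
  by rewrite expectZr ?expectZ ?expect_monomial//; exact: moderateZ.
rewrite -mul2n ler_pdivrMr ?ltr0n ?fact_gt0//.
rewrite (le_trans (ler_wpM2l _ (le_trans (ler_norm _) (HA k))))// ?exprn_ge0//.
rewrite mulrA ler_wpM2r// -exprMn lerXn2r// nnegrE ?mulr_ge0//.
Qed.

Definition expect2 (K : R -> R -> R) : R := expect (fun x => expect (K x)).

(** The second clause makes the outer integral of [expect2] meaningful. Stability under products
    [f x * g y] and finite sums covers all kernels below, without product measures. *)
Definition moderate2 (K : R -> R -> R) : Prop :=
  (forall x, moderate (K x)) /\ moderate (fun x => expect (K x)).

Lemma moderate2_prod f g : moderate f -> moderate g -> moderate2 (fun x y => f x * g y).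
Proof.
move=> mf mg; split=> [x|]; first exact: moderateZ.
apply: eq_moderate (moderateM mf (moderate_cst (expect g))) => x.
by rewrite expectZ.
Qed.

Lemma expect2_prod f g : moderate f -> moderate g ->
  expect2 (fun x y => f x * g y) = expect f * expect g.
Proof.
move=> mf mg; rewrite /expect2; under eq_fun do rewrite expectZ//.
by rewrite expectZr.
Qed.

Lemma moderate2D K L : moderate2 K -> moderate2 L ->
  moderate2 (fun x y => K x y + L x y).
Proof.
move=> [mK mIK] [mL mIL]; split=> [x|]; first exact: moderateD.
by apply: eq_moderate (moderateD mIK mIL) => x; rewrite expectD.
Qed.

Lemma expect2D K L : moderate2 K -> moderate2 L ->
  expect2 (fun x y => K x y + L x y) = expect2 K + expect2 L.
Proof.
move=> [mK mIK] [mL mIL]; rewrite /expect2 -expectD//.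
by congr expect; apply/funext => x; rewrite expectD.
Qed.

Lemma moderate2Z a K : moderate2 K -> moderate2 (fun x y => a * K x y).
Proof.
move=> [mK mIK]; split=> [x|]; first exact: moderateZ.
by apply: eq_moderate (moderateZ a mIK) => x; rewrite expectZ.
Qed.

Lemma expect2Z a K : moderate2 K -> expect2 (fun x y => a * K x y) = a * expect2 K.
Proof.
move=> [mK mIK]; rewrite /expect2 -expectZ//.
by congr expect; apply/funext => x; rewrite expectZ.
Qed.

Lemma eq_moderate2 K L : K =2 L -> moderate2 K -> moderate2 L.
Proof. by move=> KL; have -> : K = L by apply/funext => x; apply/funext => y. Qed.

Lemma moderate2B K L : moderate2 K -> moderate2 L ->
  moderate2 (fun x y => K x y - L x y).
Proof.
move=> mK mL; apply: eq_moderate2 (moderate2D mK (moderate2Z (-1) mL)) => x y.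
by rewrite mulN1r.
Qed.

Lemma expect2B K L : moderate2 K -> moderate2 L ->
  expect2 (fun x y => K x y - L x y) = expect2 K - expect2 L.
Proof.
move=> mK mL; have := expect2D mK (moderate2Z (-1) mL).
rewrite expect2Z// mulN1r => <-.
by congr expect2; apply/funext => x; apply/funext => y; rewrite mulN1r.
Qed.

Lemma moderate2_sum (n : nat) (K : nat -> R -> R -> R) : (forall i, moderate2 (K i)) ->
  moderate2 (fun x y => \sum_(i < n) K i x y).
Proof.
move=> mK; elim: n => [|n IH].
  apply: eq_moderate2 (moderate2_prod (moderate_cst 0) (moderate_cst 0)) => x y.
  by rewrite big_ord0 mul0r.
by apply: eq_moderate2 (moderate2D IH (mK n)) => x y; rewrite big_ord_recr.
Qed.

Lemma expect2_sum (n : nat) (K : nat -> R -> R -> R) : (forall i, moderate2 (K i)) ->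
  expect2 (fun x y => \sum_(i < n) K i x y) = \sum_(i < n) expect2 (K i).
Proof.
move=> mK; rewrite /expect2 -(expect_sum n (f := fun i x => expect (K i x))); last first.
  by move=> i; have [] := mK i.
congr expect; apply/funext => x; apply: (expect_sum n (f := fun i => K i x)) => i.
by have [+ _] := mK i.
Qed.

Lemma norm_expect2_le K L : moderate2 K -> moderate2 L ->
  (forall x y, `|K x y| <= L x y) -> `|expect2 K| <= expect2 L.
Proof.
move=> [mK mIK] [mL mIL] KL; apply: norm_expect_le => // x.
exact: norm_expect_le.
Qed.

Lemma expect_poly (s : nat) (Q : {poly R}) :
  expect (fun x => x ^+ s * Q.[x ^+ 2]) = \sum_(i < size Q) Q`_i * m (2 * i + s)%N.
Proof.
have mX k : moderate (fun x : R => x ^+ k) by exact/moderateX/moderate_id.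
transitivity (expect (fun x => \sum_(i < size Q) Q`_i * x ^+ (2 * i + s))).
  congr expect; apply/funext => x; rewrite horner_coef mulr_sumr.
  by apply: eq_bigr => i _; rewrite mulrCA -exprM -exprD addnC.
rewrite (expect_sum _ (f := fun i x => Q`_i * x ^+ (2 * i + s))) => [|i]; last exact: moderateZ.
by apply: eq_bigr => i _; rewrite expectZ// expect_monomial.
Qed.

(** Common form of the polynomial kernels: [a i h = 1] gives [poly_S] and [a i h = i - h] gives
    [poly_N]. *)
Let kernel (s : nat) (Q : {poly R}) (a : nat -> nat -> R) (x y : R) :=
  x ^+ s * \sum_(i < size Q) Q`_i *
    \sum_(h < i) a i h * ((y ^+ 2) ^+ h * (x ^+ 2) ^+ (i - h.+1)).

Let kernelP s Q a : moderate2 (kernel s Q a) /\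
  expect2 (kernel s Q a) = \sum_(i < size Q) Q`_i *
    \sum_(h < i) a i h * (m (2 * h)%N * m (2 * (i - h.+1) + s)%N).
Proof.
have mX k : moderate (fun x : R => x ^+ k) by exact/moderateX/moderate_id.
pose k0 i h (x y : R) := a i h * (x ^+ (2 * (i - h.+1) + s) * y ^+ (2 * h)).
pose k1 i (x y : R) := Q`_i * \sum_(h < i) k0 i h x y.
have m0 i h : moderate2 (k0 i h) by apply: moderate2Z; exact: moderate2_prod.
have m1 i : moderate2 (k1 i) by apply: moderate2Z; apply: moderate2_sum => h; exact: m0.
have -> : kernel s Q a = (fun x y => \sum_(i < size Q) k1 i x y).
  apply/funext => x; apply/funext => y; rewrite /kernel mulr_sumr.
  apply: eq_bigr => i _; rewrite mulrCA mulr_sumr; congr (_ * _).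
  by apply: eq_bigr => h _; rewrite /k0 mulrCA exprD !exprM; congr (_ * _); ring.
split; first exact: moderate2_sum.
rewrite expect2_sum//; apply: eq_bigr => i _.
rewrite /k1 expect2Z; last by apply: moderate2_sum => h; exact: m0.
rewrite (expect2_sum _ (K := k0 i))//; congr (_ * _); apply: eq_bigr => h _.
rewrite /k0 expect2Z; last exact: moderate2_prod.
by rewrite expect2_prod// !expect_monomial [m (2 * h)%N * _]mulrC.
Qed.

Lemma moderate2_poly_S s Q :
  moderate2 (fun x y => x ^+ s * poly_S Q (x ^+ 2) (y ^+ 2)).
Proof.
have [+ _] := kernelP s Q (fun _ _ => 1); apply: eq_moderate2 => x y.
rewrite /kernel /poly_S; congr (_ * _); apply: eq_bigr => i _; congr (_ * _).
by apply: eq_bigr => h _; rewrite mul1r.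
Qed.

Lemma moderate2_poly_N s Q :
  moderate2 (fun x y => x ^+ s * poly_N Q (x ^+ 2) (y ^+ 2)).
Proof. by have [] := kernelP s Q (fun i h => (i - h)%:R). Qed.

Lemma expect2_poly_S s Q :
  expect2 (fun x y => x ^+ s * poly_S Q (x ^+ 2) (y ^+ 2)) =
  \sum_(i < size Q) Q`_i *
    \sum_(h < i) m (2 * h)%N * m (2 * (i - h.+1) + s)%N.
Proof.
have [_] := kernelP s Q (fun _ _ => 1).
have -> : kernel s Q (fun _ _ => 1) = (fun x y => x ^+ s * poly_S Q (x ^+ 2) (y ^+ 2)).
  apply/funext => x; apply/funext => y; rewrite /kernel /poly_S; congr (_ * _).
  by apply: eq_bigr => i _; congr (_ * _); apply: eq_bigr => h _; rewrite mul1r.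
move=> ->; apply: eq_bigr => i _; congr (_ * _).
by apply: eq_bigr => h _; rewrite mul1r.
Qed.

Lemma expect2_poly_N s Q :
  expect2 (fun x y => x ^+ s * poly_N Q (x ^+ 2) (y ^+ 2)) =
  \sum_(i < size Q) Q`_i *
    \sum_(h < i) (i - h)%:R * (m (2 * h)%N * m (2 * (i - h.+1) + s)%N).
Proof. by have [] := kernelP s Q (fun i h => (i - h)%:R). Qed.

Lemma expect_poly_deriv (s : nat) (Q : {poly R}) :
  expect (fun x => x ^+ s * Q^`().[x ^+ 2]) =
  \sum_(i < size Q) Q`_i * (i%:R * m (2 * i.-1 + s)%N).
Proof.
have mX k : moderate (fun x : R => x ^+ k) by exact/moderateX/moderate_id.
transitivity (expect (fun x => \sum_(i < size Q) Q`_i * i%:R * x ^+ (2 * i.-1 + s))).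
  congr expect; apply/funext => x; rewrite horner_deriv_sum mulr_sumr.
  by apply: eq_bigr => i _; rewrite exprD exprM; ring.
rewrite (expect_sum _ (f := fun i x => Q`_i * i%:R * x ^+ (2 * i.-1 + s))); last first.
  by move=> i; exact: moderateZ.
by apply: eq_bigr => i _; rewrite expectZ// expect_monomial mulrA.
Qed.

End expectation.

Lemma norm_combination_le (R : realFieldType) (n k x y z u v : R) :
    0 <= n -> `|k| <= 2 -> `|x| <= u -> `|y| <= v -> `|z| <= v ->
  `|n * x + 4 * y - k * z| <= n * u + 6 * v.
Proof.
move=> n0 k2 xu yv zv.
rewrite (le_trans (ler_normB _ _))// (_ : 6 * v = 4 * v + 2 * v); last by ring.
rewrite addrA lerD ?normrM ?ler_pM//.
rewrite (le_trans (ler_normD _ _))// !normrM (ger0_norm n0) (@ger0_norm _ 4)//.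
by rewrite lerD// ler_wpM2l.
Qed.

(** * Time derivative of the integral of a test function *)

Section test_function.
Variables (R : realType) (nu0 : R) (c : nat -> R -> R).
Variable mu_ : R -> probability (measurableTypeR R) R.
Hypothesis nu0_ge0 : 0 <= nu0.
Hypothesis c_poly : forall (l : nat) (s : bool), exists p : {poly R},
  forall t : R, 0 <= t ->
  c (2 * l + s)%N t = p.[t] /\ p^`().[t] = moment_rate nu0 c s l t.
Hypothesis c_bound : forall T : R, 0 <= T -> exists2 A : R, 0 < A &
  forall (l : nat) (t : R), 0 <= t <= T ->
    `|c (2 * l)%N t| <= A ^+ l * (2 * l)`!%:R.
Hypothesis mu_t_moments : forall t : R, 0 <= t -> has_moments (mu_ t) (c^~ t).

Definition test_rate (s : bool) (F1 : R -> R) (S N : R -> R -> R) (t : R) : R :=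
  2 * nu0 * expect (mu_ t) (fun x => x ^+ s * F1 (x ^+ 2)) +
  4 * expect2 (mu_ t) (fun x y => x ^+ s * N (x ^+ 2) (y ^+ 2)) -
  (if s then 0 else 2) *
    expect2 (mu_ t) (fun x y => x ^+ s * S (x ^+ 2) (y ^+ 2)).

Lemma test_rate_poly (s : bool) (P : {poly R}) (t : R) : 0 <= t ->
  test_rate s (horner P^`()) (poly_S P) (poly_N P) t =
  \sum_(i < size P) P`_i * moment_rate nu0 c s i t.
Proof.
move=> t0; have Pm := mu_t_moments t0.
rewrite /test_rate (expect_poly_deriv Pm) (expect2_poly_N Pm) (expect2_poly_S Pm).
rewrite !mulr_sumr -big_split -sumrB /=; apply: eq_bigr => i _.
rewrite mulrBr mulrDr !(mulrCA P`_i); congr (_ + _ - _); ring.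
Qed.

(** For a polynomial [P] in place of [F] the identity holds exactly by [test_rate_poly].
    Approximating [F] with two derivatives makes both the integral and its rate close to those of
    [P], uniformly on [[0, t + 1]], and [uniform_limit_derivative] concludes. *)
Theorem test_function_derivative (s : bool) (F F1 F2 : R -> R)
    (S N : R -> R -> R) (L : R) (t : R) :
    0 <= L -> halfline_derivative F F1 -> halfline_derivative F1 F2 ->
    (forall p q : R, 0 <= p -> 0 <= q -> `|F2 p - F2 q| <= L * `|p - q|) ->
    difference_kernels F F1 F2 S N ->
    moderate (fun x => F (x ^+ 2)) -> moderate (fun x => F1 (x ^+ 2)) ->
    (forall r, 0 <= r ->
      moderate2 (mu_ r) (fun x y => x ^+ s * S (x ^+ 2) (y ^+ 2)) /\
      moderate2 (mu_ r) (fun x y => x ^+ s * N (x ^+ 2) (y ^+ 2))) ->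
    0 <= t ->
  let g r := expect (mu_ r) (fun x => x ^+ s * F (x ^+ 2)) in
  (r - t)^-1 * (g r - g t) @[r --> within (fun r : R => 0 <= r) t^'] -->
    test_rate s F1 S N t.
Proof.
move=> L0 dF dF1 F2L FK mF mF1 mK t0 g.
apply: uniform_limit_derivative => // e e0.
have T0 : 0 <= t + 1 by rewrite addr_ge0.
have [A A0 HA] := c_bound T0.
(* [128 = 16 * 4 * 2]: the approximation uses the weight [16 * b], the factor [1 + x ^ 2] raises it
   to [64 * b], and [expect_weight_le2] requires [64 * b * A <= 1 / 2]. *)
pose b : R := (128 * A)^-1.
have b0 : 0 < b by rewrite invr_gt0 mulr_gt0.
pose D : R := 1 + (16 * b)^-1.
have D0 : 0 < D by rewrite addr_gt0 ?invr_gt0 ?mulr_gt0.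
(* Sum of all errors per unit of [d]: [2 * D] for the integral itself, [2 * nu0 * (2 * D)] for the
   drift, and [4 + 2] times [4 * (D * (1 + 2 * A))] for the two double integrals. The factor
   [1 + 2 * A] bounds the expectation of [1 + x ^ 2]. *)
pose C : R := 2 * D + 4 * nu0 * D + 24 * (D * (1 + 2 * A)).
have A1 : 0 < 1 + 2 * A by rewrite addr_gt0 ?mulr_gt0.
have DA := mulr_gt0 D0 A1.
have nD : 0 <= nu0 * D by rewrite mulr_ge0 ?(ltW D0).
have C0 : 0 < C by rewrite /C; lra.
have CD : 2 * D <= C by rewrite /C; lra.
pose d := e / C; have d0 : 0 < d by rewrite divr_gt0.
have [P [n HP]] := approximation_C2 b0 L0 dF dF1 F2L d0.
have /choice [q Hq] := fun i => c_poly i s.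
exists (\sum_(i < size P) P`_i *: q i) => r /andP[r0 rT].
have Pm := mu_t_moments r0.
have rT' : 0 <= r <= t + 1 by rewrite r0.
have -> : (\sum_(i < size P) P`_i *: q i).[r] =
    expect (mu_ r) (fun x => x ^+ s * P.[x ^+ 2]).
  rewrite (expect_poly Pm) horner_sum; apply: eq_bigr => i _.
  by rewrite hornerZ; have [-> _] := Hq i _ r0.
have -> : (\sum_(i < size P) P`_i *: q i)^`().[r] =
    test_rate s (horner P^`()) (poly_S P) (poly_N P) r.
  rewrite test_rate_poly// raddf_sum horner_sum; apply: eq_bigr => i _ /=.
  by rewrite derivZ hornerZ; have [_ ->] := Hq i _ r0.
have mX k : moderate (fun x : R => x ^+ k) by exact/moderateX/moderate_id.
pose u (x : R) := 1 + x ^+ 2; pose W (x : R) := weight (16 * b) n (x ^+ 2).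
have mu_u : moderate u by apply: moderateD (moderate_cst 1) (mX 2%N).
have mW : moderate W by exact: moderate_weight.
have mP Q : moderate (fun x : R => x ^+ s * Q.[x ^+ 2]).
  by apply: moderateM => //; exact: moderate_horner.
have b16 : 0 < 16 * b by rewrite mulr_gt0.
have W0 x : 0 <= W x by rewrite /W weight_ge0 ?sqr_ge0// ltW.
have u1 x : 1 <= u x by rewrite /u lerDl sqr_ge0.
have us x : `|x ^+ s| <= u x by exact: norm_expr_bool_le.
have uW : expect (mu_ r) (fun x => u x * W x) <= 2 * D.
  apply: (@le_trans _ _ (expect (mu_ r) (fun x => D * weight (64 * b) n.+1 (x ^+ 2)))).
    apply: (le_expect Pm); [exact: moderateM|by apply: moderateZ; exact: moderate_weight|].
    move=> x; rewrite /u mulrDl mul1r /D mulrDl mul1r lerD//.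
      rewrite /W weight_homo ?sqr_ge0 ?lexx//= (ltW b16)/=.
      by rewrite ler_pM2r// ler_nat.
    have := mul_weight_le n b16 (sqr_ge0 x).
    by rewrite mulrA -natrM.
  rewrite (expectZ Pm); last exact: moderate_weight.
  rewrite mulrC ler_pM2r//.
  apply: (expect_weight_le2 (A := A) Pm); rewrite ?(ltW A0) ?mulr_ge0 ?(ltW b0)//.
    rewrite /b le_eqVlt; apply/orP; left; apply/eqP; field; exact: lt0r_neq0.
  by move=> l; exact: HA.
have Eu : expect (mu_ r) u <= 1 + 2 * A.
  rewrite /u (expectD Pm) ?(expect_cst (mu_ r)) ?(expect_monomial Pm)//; last exact: moderate_cst.
  rewrite lerD2l; have := HA 1%N r rT'.
  by rewrite muln1 expr1 (_ : 2`! = 2%N)// mulrC; exact/le_trans/ler_norm.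
have uW0 : 0 <= expect (mu_ r) (fun x => u x * W x).
  by apply: Rintegral_ge0 => x _; apply: mulr_ge0 => //; exact: le_trans (u1 x).
have E1 (G : R -> R) (Q : {poly R}) : moderate (fun x => G (x ^+ 2)) ->
    (forall p, 0 <= p -> `|G p - Q.[p]| <= d * weight (16 * b) n p) ->
    `|expect (mu_ r) (fun x => x ^+ s * G (x ^+ 2)) -
      expect (mu_ r) (fun x => x ^+ s * Q.[x ^+ 2])| <= d * (2 * D).
  move=> mG GQ; have mG' := moderateM (mX s) mG.
  rewrite -(expectB Pm)//; apply: (@le_trans _ _ (expect (mu_ r) (fun x => d * (u x * W x)))).
    apply: (norm_expect_le Pm); [exact: moderateB|by apply: moderateZ; exact: moderateM|].
    move=> x; rewrite -mulrBr normrM mulrCA ler_pM//.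
    exact/GQ/sqr_ge0.
  by rewrite (expectZ Pm) ?ler_pM2l//; exact: moderateM.
have E2 (K K' : R -> R -> R) :
    moderate2 (mu_ r) (fun x y => x ^+ s * K (x ^+ 2) (y ^+ 2)) ->
    moderate2 (mu_ r) (fun x y => x ^+ s * K' (x ^+ 2) (y ^+ 2)) ->
    (forall p q, 0 <= p -> 0 <= q -> `|K p q - K' p q| <=
        d * ((1 + q) * (weight (16 * b) n p + weight (16 * b) n q))) ->
    `|expect2 (mu_ r) (fun x y => x ^+ s * K (x ^+ 2) (y ^+ 2)) -
      expect2 (mu_ r) (fun x y => x ^+ s * K' (x ^+ 2) (y ^+ 2))| <=
    d * (4 * (D * (1 + 2 * A))).
  move=> mKs mKs' KK'.
  (* The majorant is split into products of functions of one variable, so that its double integral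
     is a sum of products of expectations. *)
  pose M x y := d * ((u x * W x) * u y + u x * (u y * W y)).
  have muW : moderate (fun x => u x * W x) by exact: moderateM.
  have m1 := moderate2_prod Pm muW mu_u; have m2 := moderate2_prod Pm mu_u muW.
  rewrite -(expect2B Pm)//; apply: (@le_trans _ _ (expect2 (mu_ r) M)).
    apply: (norm_expect2_le Pm); first exact: (moderate2B Pm).
      by apply: (moderate2Z Pm); exact: (moderate2D Pm).
    move=> x y; rewrite -mulrBr normrM.
    have := KK' _ _ (sqr_ge0 x) (sqr_ge0 y); rewrite -/(u y) -/(W x) -/(W y) => H.
    have -> : M x y = u x * (d * (u y * (W x + W y))) by rewrite /M; ring.
    by rewrite ler_pM.
  rewrite (expect2Z Pm); last exact: (moderate2D Pm).
  rewrite (expect2D Pm)// !(expect2_prod Pm)// ler_pM2l//.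
  rewrite [X in _ + X]mulrC -mulr2n -[X in X <= _]mulr_natl.
  have -> : 4 * (D * (1 + 2 * A)) = 2 * ((2 * D) * (1 + 2 * A)) by ring.
  rewrite ler_pM2l// ler_pM//.
  rewrite (le_trans ler01)//; rewrite -[leLHS](expect_cst (mu_ r)) (le_expect Pm)//.
  exact: moderate_cst.
have KB : forall p q : R, 0 <= p -> 0 <= q ->
   `|S p q - poly_S P p q| <= d * (weight (16 * b) n p + weight (16 * b) n q) /\
   `|N p q - poly_N P p q| <= (1 + q) * (d * (weight (16 * b) n p + weight (16 * b) n q)).
  move=> p p' p0 p'0; rewrite mulrDr.
  apply: (@difference_kernels_bound _ (fun x => F x - P.[x]) (fun x => F1 x - P^`().[x])
    (fun x => F2 x - P^`()^`().[x]) (fun x => d * weight (16 * b) n x)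
    (fun x y => S x y - poly_S P x y) (fun x y => N x y - poly_N P x y)) => //.
  - move=> x y x0 y0; have [K1 K2 K3 K4] := FK x y x0 y0.
    have [Q1 Q2 Q3 Q4] := poly_difference_kernels P x0 y0.
    split.
    + by rewrite mulrBr K1 Q1; ring.
    + by rewrite mulrBr K2 Q2; ring.
    + by rewrite K3 Q3.
    + by rewrite mulrBr K4 Q4; ring.
  - exact: halfline_C1B (halfline_derivative_C1 dF) (halfline_C1_horner _).
  - exact: halfline_C1B (halfline_derivative_C1 dF1) (halfline_C1_horner _).
  - by move=> x /HP[].
  - by move=> x /HP[].
  - by move=> x y x0 xy; rewrite ler_pM2l// weight_homo ?lexx ?(ltW b16) ?x0.
have [mS mN] := mK r r0.
have dC : d * C = e by rewrite divfK// gt_eqF.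
split.
  rewrite (le_trans (E1 F P mF _))//; first by move=> p /HP[].
  by rewrite -dC ler_pM2l.
have H1 := E1 F1 P^`() mF1 (fun p p0 => let: And3 _ h _ := HP p p0 in h).
have NB : forall p q : R, 0 <= p -> 0 <= q -> `|N p q - poly_N P p q| <=
    d * ((1 + q) * (weight (16 * b) n p + weight (16 * b) n q)).
  by move=> x y x0 y0; rewrite mulrCA; have [] := KB x y x0 y0.
have SB : forall p q : R, 0 <= p -> 0 <= q -> `|S p q - poly_S P p q| <=
    d * ((1 + q) * (weight (16 * b) n p + weight (16 * b) n q)).
  move=> x y x0 y0; have [H _] := KB x y x0 y0; apply: le_trans H _.
  by rewrite ler_pM2l// ler_peMl ?lerDl// addr_ge0// weight_ge0// ltW.
have H2 := E2 _ _ mN (moderate2_poly_N Pm s P) NB.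
have H3 := E2 _ _ mS (moderate2_poly_S Pm s P) SB.
rewrite /test_rate.
move: H1 H2 H3; set a1 := expect _ _; set a2 := expect _ _.
set a3 := expect2 _ _; set a4 := expect2 _ _; set a5 := expect2 _ _; set a6 := expect2 _ _.
move=> H1 H2 H3; set k : R := if s then 0 else 2.
have k2 : `|k| <= 2 by rewrite /k; case: (s); rewrite ?normr0// ger0_norm.
have -> : 2 * nu0 * a1 + 4 * a3 - k * a5 - (2 * nu0 * a2 + 4 * a4 - k * a6) =
  2 * nu0 * (a1 - a2) + 4 * (a3 - a4) - k * (a5 - a6) by ring.
have n2 : 0 <= 2 * nu0 by rewrite mulr_ge0.
apply: le_trans (norm_combination_le n2 k2 H1 H2 H3) _.
rewrite -dC; have -> : 2 * nu0 * (d * (2 * D)) + 6 * (d * (4 * (D * (1 + 2 * A)))) =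
  d * (C - 2 * D) by rewrite /C; ring.
by rewrite ler_pM2l// gerBl mulr_ge0// ltW.
Qed.

End test_function.

(** * Integrals against signed measures *)

Section bounded_integral.
Context d (T : measurableType d) (R : realType).
Implicit Types m : {measure set T -> \bar R}.

Definition measurable_bounded (f : T -> R) : Prop :=
  measurable_fun [set: T] f /\ exists M : R, forall x, `|f x| <= M.

Lemma measurable_bounded_integrableT m (f : T -> R) :
  (m setT < +oo)%E -> measurable_bounded f -> m.-integrable setT (EFin \o f).
Proof.
move=> mT [mf [M fM]]; apply: measurable_bounded_integrable => //.
exists M; split; first exact: num_real.
by move=> x Mx y _; exact: le_trans (fM y) (ltW Mx).
Qed.

Lemma Rintegral_measure_add m1 m2 (f : T -> R) :
    (m1 setT < +oo)%E -> (m2 setT < +oo)%E -> measurable_bounded f ->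
  \int[measure_add m1 m2]_x f x = \int[m1]_x f x + \int[m2]_x f x.
Proof.
move=> m1T m2T bf; have i1 := measurable_bounded_integrableT m1T bf.
have i2 := measurable_bounded_integrableT m2T bf.
rewrite /Rintegral (integral_measure_add measurableT i1 i2).
by rewrite fineD//; exact: integrable_fin_num.
Qed.

Lemma measure_add_lt_pinfty m1 m2 : (m1 setT < +oo)%E -> (m2 setT < +oo)%E ->
  (measure_add m1 m2 setT < +oo)%E.
Proof. by move=> h1 h2; rewrite measure_addE lte_add_pinfty. Qed.

Lemma eq_measure_Rintegral m1 m2 (f : T -> R) :
    (forall A, measurable A -> m1 A = m2 A) ->
  \int[m1]_x f x = \int[m2]_x f x.
Proof.
by move=> m12; rewrite /Rintegral (eq_measure_integral m2)// => A mA _; exact: m12.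
Qed.

(** The Jordan parts need not be identified: [2 rho + m2 = m1] becomes [2 rho+ + m2 = 2 rho- + m1],
    an equality of finite positive measures that can be integrated term by term. The hypothesis is
    additive to avoid subtracting extended reals. *)
Lemma charge_integral_half (rho : {charge set T -> \bar R}) m1 m2 (f : T -> R) :
    (m1 setT < +oo)%E -> (m2 setT < +oo)%E -> measurable_bounded f ->
    (forall A, measurable A -> (rho A + rho A + m2 A = m1 A)%E) ->
  charge_integral rho f = (\int[m1]_x f x - \int[m2]_x f x) / 2.
Proof.
move=> m1T m2T bf rhoE; rewrite /charge_integral.
pose jp : {measure set T -> \bar R} := jordan_pos (hahn_posneg rho).
pose jn : {measure set T -> \bar R} := jordan_neg (hahn_posneg rho).
rewrite -/jp -/jn.
have fjp A : measurable A -> jp A \is a fin_num by move=> mA; exact: fin_num_measure.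
have fjn A : measurable A -> jn A \is a fin_num by move=> mA; exact: fin_num_measure.
have jpT : (jp setT < +oo)%E by rewrite ltey_eq fjp.
have jnT : (jn setT < +oo)%E by rewrite ltey_eq fjn.
have H A : measurable A ->
    measure_add (measure_add jp jp) m2 A = measure_add (measure_add jn jn) m1 A.
  move=> mA; have JD : rho A = (jp A - jn A)%E.
    by rewrite (jordan_decomp (hahn_posneg rho) mA) /cadd /= cscaleN1.
  have E (j m : {measure set T -> \bar R}) :
      measure_add (measure_add j j) m A = (j A + j A + m A)%E.
    by rewrite measure_addE; congr (_ + _)%E; exact: measure_addE.
  rewrite !E -rhoE// JD.
  rewrite -(fineK (fjp _ mA)) -(fineK (fjn _ mA)) [RHS]addeA.
  by congr (_ + _)%E; rewrite -!EFinN -!EFinD; congr EFin; ring.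
have := eq_measure_Rintegral f H.
rewrite !Rintegral_measure_add//; try exact: measure_add_lt_pinfty.
by move=> E; apply: (mulIf (_ : 2 != 0 :> R)) => //; rewrite divfK//; lra.
Qed.

End bounded_integral.

Section even_odd_integral.
Variables (R : realType) (P : probability (measurableTypeR R) R).

Let PT (Q : probability (measurableTypeR R) R) : (Q setT < +oo)%E.
Proof. by rewrite ltey_eq fin_num_measure. Qed.

Lemma Rintegral_reflection (f : measurableTypeR R -> R) : measurable_bounded f ->
  \int[reflection P]_x f x = \int[P]_x f (- (x : R)).
Proof.
move=> bf; rewrite /Rintegral /reflection /distribution integral_pushforward//.
- by apply/measurable_EFinP; case: bf.
- rewrite preimage_setT; apply: measurable_bounded_integrableT; first exact: PT.
  case: bf => mf [M fM]; split; last by exists M => x; exact: fM.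
  by apply: measurableT_comp => //; exact: oppr_measurable.
Qed.

Let finQ (Q : probability (measurableTypeR R) R) (A : set (measurableTypeR R)) :
  measurable A -> Q A \is a fin_num.
Proof. by move=> mA; exact: fin_num_measure. Qed.

Lemma charge_integral_even (f : measurableTypeR R -> R) : measurable_bounded f ->
  charge_integral (even_part P) f =
  (\int[P]_x f x + \int[P]_x f (- (x : R))) / 2.
Proof.
move=> bf.
rewrite (@charge_integral_half _ _ _ _ (measure_add P (reflection P)) mzero)//.
- have -> : \int[measure_add P (reflection P)]_x f x =
      \int[P]_x f x + \int[reflection P]_x f x.
    by apply: Rintegral_measure_add => //; exact: PT.
  rewrite Rintegral_reflection//.
  by rewrite /Rintegral integral_measure_zero subr0.
- by apply: measure_add_lt_pinfty; exact: PT.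
- by rewrite /mzero ltry.
- move=> A mA; have half (p q : \bar R) : p \is a fin_num -> q \is a fin_num ->
      ((2^-1)%:E * (p + q) + (2^-1)%:E * (p + q) + 0 = p + q)%E.
    move=> /fineK <- /fineK <-; set a := fine _; set b := fine _.
    rewrite -[LHS]/((2^-1 * (a + b) + 2^-1 * (a + b) + 0)%:E) -[RHS]/((a + b)%:E).
    by congr EFin; field.
  transitivity (P A + reflection P A)%E; last by rewrite [RHS]measure_addE.
  by apply: (half (P A) (reflection P A)); exact: finQ.
Qed.

Lemma charge_integral_odd (f : measurableTypeR R -> R) : measurable_bounded f ->
  charge_integral (odd_part P) f =
  (\int[P]_x f x - \int[P]_x f (- (x : R))) / 2.
Proof.
move=> bf; rewrite (@charge_integral_half _ _ _ _ P (reflection P)); [|exact: PT..|by []|].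
  by rewrite Rintegral_reflection.
move=> A mA; have half (p q : \bar R) : p \is a fin_num -> q \is a fin_num ->
    ((2^-1)%:E * (p - q) + (2^-1)%:E * (p - q) + q = p)%E.
  move=> /fineK <- /fineK <-; set a := fine _; set b := fine _.
  rewrite -[LHS]/((2^-1 * (a - b) + 2^-1 * (a - b) + b)%:E).
  by congr EFin; field.
by apply: (half (P A) (reflection P A)); exact: finQ.
Qed.

End even_odd_integral.

(** * The real modulus and the plane cut along the half-line *)

(** [|z|] is itself an element of [R[i]]; a real value is needed to compare with real integrals. *)
Definition cnorm (R : realType) (z : R[i]) : R := complex.Re `|z|.

Section cnorm.
Variable R : realType.
Implicit Types z w : R[i].

Lemma cnormE z : (cnorm z)%:C = `|z|.
Proof. by rewrite /cnorm normc_def. Qed.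

Lemma cnorm_ge0 z : 0 <= cnorm z.
Proof. by rewrite -ler0c cnormE. Qed.

Lemma cnormM z w : cnorm (z * w) = cnorm z * cnorm w.
Proof. by apply: complexI; rewrite rmorphM/= !cnormE normrM. Qed.

Lemma cnormV z : cnorm z^-1 = (cnorm z)^-1.
Proof. by apply: complexI; rewrite fmorphV/= !cnormE normfV. Qed.

Lemma cnormX z (n : nat) : cnorm (z ^+ n) = cnorm z ^+ n.
Proof. by apply: complexI; rewrite rmorphXn/= !cnormE normrX. Qed.

Lemma cnormN z : cnorm (- z) = cnorm z.
Proof. by rewrite /cnorm normrN. Qed.

Lemma cnormD z w : cnorm (z + w) <= cnorm z + cnorm w.
Proof. by rewrite -lecR rmorphD/= !cnormE ler_normD. Qed.

Lemma cnormB z w : cnorm (z - w) <= cnorm z + cnorm w.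
Proof. by rewrite -(cnormN w) cnormD. Qed.

Lemma cnorm_real (r : R) : cnorm r%:C = `|r|.
Proof. by rewrite /cnorm normc_def/= expr0n addr0 sqrtr_sqr. Qed.

Lemma cnorm_eq0 z : (cnorm z == 0) = (z == 0).
Proof. by rewrite -(inj_eq (@complexI R)) cnormE rmorph0 normr_eq0. Qed.

Lemma cnorm_gt0 z : (0 < cnorm z) = (z != 0).
Proof. by rewrite lt_def cnorm_ge0 andbT cnorm_eq0. Qed.

Lemma Re_le_cnorm z : `|complex.Re z| <= cnorm z.
Proof. by rewrite -lecR cnormE normc_ge_Re. Qed.

Lemma Im_le_cnorm z : `|complex.Im z| <= cnorm z.
Proof.
rewrite /cnorm normc_def/= -sqrtr_sqr ler_wsqrtr// lerDr; exact: sqr_ge0.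
Qed.

Lemma cnorm_le_ReIm z : cnorm z <= `|complex.Re z| + `|complex.Im z|.
Proof.
have {1}-> : z = (complex.Re z)%:C + 'i * (complex.Im z)%:C by exact: complexE.
rewrite (le_trans (cnormD _ _))// cnormM !cnorm_real.
by rewrite /cnorm normc_def/= expr0n/= expr1n add0r sqrtr1 mul1r.
Qed.

Lemma Re_mul z w : complex.Re (z * w) =
  complex.Re z * complex.Re w - complex.Im z * complex.Im w.
Proof. by case: z w => [a b] [c d]. Qed.

Lemma Im_mul z w : complex.Im (z * w) =
  complex.Re z * complex.Im w + complex.Im z * complex.Re w.
Proof. by case: z w => [a b] [c d]. Qed.

(* [false] selects the real part and [true] the imaginary part. *)
Definition part (b : bool) z : R := if b then complex.Im z else complex.Re z.

Lemma partD b z w : part b (z + w) = part b z + part b w.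
Proof. by case: b z w => [] [? ?] [? ?]. Qed.

Lemma partN b z : part b (- z) = - part b z.
Proof. by case: b z => [] [? ?]. Qed.

Lemma partB b z w : part b (z - w) = part b z - part b w.
Proof. by rewrite partD partN. Qed.

Lemma partZ b (r : R) z : part b (r%:C * z) = r * part b z.
Proof. by case: b z => [] [u v] /=; rewrite mul0r ?subr0 ?addr0. Qed.

Lemma part_le_cnorm b z : `|part b z| <= cnorm z.
Proof. by case: b; [exact: Im_le_cnorm|exact: Re_le_cnorm]. Qed.

Lemma complex_partE z : z = part false z +i* part true z.
Proof. by case: z. Qed.

Lemma eq_part z w : (forall b, part b z = part b w) -> z = w.
Proof. by move=> H; rewrite (complex_partE z) (complex_partE w) !H. Qed.

Definition off_halfline z : Prop := complex.Im z != 0 \/ complex.Re z < 0.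

Lemma off_halfline_dist z : off_halfline z ->
  exists2 d : R, 0 < d & forall p : R, 0 <= p -> d <= cnorm (z - p%:C).
Proof.
case=> [z0|z0].
  exists `|complex.Im z|; first by rewrite normr_gt0.
  move=> p _; have := Im_le_cnorm (z - p%:C).
  by case: z {z0} => a b /=; rewrite subr0.
exists (- complex.Re z); first by rewrite oppr_gt0.
move=> p p0; apply: le_trans (Re_le_cnorm _).
by case: z z0 => a b /= a0; rewrite -normrN (le_trans _ (ler_norm _))// opprB lerDr.
Qed.

Lemma off_halfline_sqr z : complex.Im z != 0 -> off_halfline (z ^+ 2).
Proof.
case: z => a b /= b0; rewrite /off_halfline expr2.
have [->|a0] := eqVneq a 0.
  by right; rewrite /= mul0r sub0r oppr_lt0 -expr2 exprn_even_gt0.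
by left; rewrite /= mulrC -mulr2n mulrn_eq0/= mulf_neq0.
Qed.

(** This is why the relations [G_even z = z * tGeven (z ^ 2)] and [G_odd z = tGodd (z ^ 2)] at
    nonreal [z] determine [tGeven] and [tGodd] on the whole cut plane. *)
Lemma off_halfline_sqrt z : off_halfline z -> exists2 w, complex.Im w != 0 & z = w ^+ 2.
Proof.
move=> z_off; exists (sqrtc z); last by rewrite sqr_sqrtc.
apply/negP => /eqP w0; move: z_off; rewrite -(sqr_sqrtc z).
case: (sqrtc z) w0 => a b /= ->; rewrite expr2 /off_halfline/= !mulr0 subr0 mul0r addr0.
by rewrite eqxx -expr2 ltNge sqr_ge0; case.
Qed.

Lemma off_halfline_near z : off_halfline z -> exists2 d : R, 0 < d &
  forall h, cnorm h < d -> off_halfline (z + h).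
Proof.
case=> [z0|z0].
  exists `|complex.Im z| => [|h hz]; first by rewrite normr_gt0.
  left; apply/negP => /eqP H; have := Im_le_cnorm h.
  have -> : complex.Im h = - complex.Im z.
    by move: H; case: (z) (h) => [? ?] [? ?] /= H; apply/eqP; rewrite -addr_eq0 addrC H.
  by rewrite normrN leNgt hz.
exists (- complex.Re z) => [|h hz]; first by rewrite oppr_gt0.
right; have := le_lt_trans (Re_le_cnorm h) hz; rewrite ltr_norml => /andP[_].
by case: (z) (h) => [? ?] [? ?] /=; lra.
Qed.

End cnorm.

(** * Lipschitz functions and complex expectations *)

Lemma moderate_lipschitz (R : realType) (G : R -> R) (L : R) : 0 <= L ->
  (forall x y, `|G x - G y| <= L * `|x - y|) -> moderate G.
Proof.
move=> L0 GL; have L1 : 0 < L + 1 by rewrite ltr_wpDl.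
split.
  move=> x; apply/cvgrPdist_le => /= e e0; near=> y.
  have xy : `|x - y| <= e / (L + 1).
    by near: y; apply: cvgr_dist_le; [exact: cvg_id|rewrite divr_gt0].
  rewrite (le_trans (GL x y))//; move: xy; rewrite ler_pdivlMr//.
  by have := normr_ge0 (x - y); nra.
exists (`|G 0| + L) => [|]; first by rewrite addr_ge0.
exists 1%N => x; rewrite expr1 -(subrK (G 0) (G x)).
rewrite (le_trans (ler_normD _ _))// (le_trans (lerD (GL x 0) (lexx _)))//.
rewrite subr0 mulrDl [leRHS]addrC lerD//.
  by rewrite ler_wpM2l//; exact: (norm_expr_bool_le x true).
by rewrite ler_peMr// lerDl sqr_ge0.
Unshelve. all: by end_near. Qed.

Lemma moderate_lipschitz_sqr (R : realType) (G : R -> R) (L : R) : 0 <= L ->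
    (forall p q : R, 0 <= p -> 0 <= q -> `|G p - G q| <= L * `|p - q|) ->
  moderate (fun x => G (x ^+ 2)).
Proof.
(* [G] is controlled on the half-line only; precomposing with the absolute value extends it to a
   Lipschitz function on the line. *)
move=> L0 GL; have mG : moderate (fun p => G `|p|).
  apply: (moderate_lipschitz L0) => x y; rewrite (le_trans (GL _ _ _ _))//.
  by rewrite ler_wpM2l// ler_dist_dist.
have [cG [C C0 [n Hn]]] := mG.
split.
  have -> : (fun x => G (x ^+ 2)) = (fun p => G `|p|) \o (fun x : R => x ^+ 2).
    by apply/funext => x /=; rewrite ger0_norm// sqr_ge0.
  move=> x; apply: continuous_comp; last exact: cG.
  exact: exprn_continuous.
exists C => //; exists (n + n)%N => x.
rewrite -[X in G X]ger0_norm ?sqr_ge0// (le_trans (Hn _))// ler_wpM2l//.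
have := sqr_ge0 x; move: (x ^+ 2) => y y0.
have y1 : 0 <= 1 + y by rewrite addr_ge0.
rewrite exprD -exprMn lerXn2r// ?nnegrE ?mulr_ge0//.
  by rewrite addr_ge0 ?sqr_ge0.
by rewrite expr2; nra.
Qed.

Section complex_expectation.
Variables (R : realType) (P : probability (measurableTypeR R) R) (m : nat -> R).
Hypothesis Pm : has_moments P m.
Implicit Types f g : R -> R[i].

Definition cexpect f : R[i] :=
  expect P (fun x => part false (f x)) +i* expect P (fun x => part true (f x)).

Definition cmoderate f : Prop := forall b, moderate (fun x => part b (f x)).

Lemma part_cexpect b f : part b (cexpect f) = expect P (fun x => part b (f x)).
Proof. by case: b. Qed.

Lemma cmoderateD f g : cmoderate f -> cmoderate g -> cmoderate (fun x => f x + g x).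
Proof.
move=> mf mg b; apply: eq_moderate (moderateD (mf b) (mg b)) => x.
by rewrite partD.
Qed.

Lemma cmoderateM f g : cmoderate f -> cmoderate g -> cmoderate (fun x => f x * g x).
Proof.
move=> mf mg [].
  apply: eq_moderate (moderateD (moderateM (mf false) (mg true))
    (moderateM (mf true) (mg false))) => x.
  by rewrite /part Im_mul.
apply: eq_moderate (moderateB (moderateM (mf false) (mg false))
  (moderateM (mf true) (mg true))) => x.
by rewrite /part Re_mul.
Qed.

Lemma cmoderate_cst (a : R[i]) : cmoderate (fun=> a).
Proof. by move=> b; exact: moderate_cst. Qed.

Lemma cmoderate_real (h : R -> R) : moderate h -> cmoderate (fun x => (h x)%:C).
Proof. by move=> mh [] //=; exact: moderate_cst. Qed.

Lemma cexpectD f g : cmoderate f -> cmoderate g ->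
  cexpect (fun x => f x + g x) = cexpect f + cexpect g.
Proof.
move=> mf mg; apply: eq_part => b; rewrite partD !part_cexpect -(expectD Pm)//.
by congr expect; apply/funext => x; rewrite partD.
Qed.

Lemma cexpectZ (a : R[i]) f : cmoderate f -> cexpect (fun x => a * f x) = a * cexpect f.
Proof.
move=> mf; apply: eq_part => -[]; rewrite part_cexpect /part.
  rewrite Im_mul -(expectZ Pm _ (mf true)) -(expectZ Pm _ (mf false)) -(expectD Pm).
  - by congr expect; apply/funext => x; rewrite Im_mul.
  - exact/moderateZ/(mf true).
  - exact/moderateZ/(mf false).
rewrite Re_mul -(expectZ Pm _ (mf true)) -(expectZ Pm _ (mf false)) -(expectB Pm).
- by congr expect; apply/funext => x; rewrite Re_mul.
- exact/moderateZ/(mf false).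
- exact/moderateZ/(mf true).
Qed.

(** The factor 2 comes from bounding the real and imaginary parts separately. *)
Lemma cnorm_cexpect_le f (g : R -> R) : cmoderate f -> moderate g ->
  (forall x, cnorm (f x) <= g x) -> cnorm (cexpect f) <= 2 * expect P g.
Proof.
move=> mf mg fg; rewrite (le_trans (cnorm_le_ReIm _))// mulr2n mulrDl mul1r.
rewrite -[complex.Re _]/(part false _) -[complex.Im _]/(part true _) !part_cexpect.
by rewrite lerD//; apply: (norm_expect_le Pm) => // x; rewrite (le_trans (part_le_cnorm _ _)).
Qed.

Lemma moderate2_part b f g : cmoderate f -> cmoderate g ->
  moderate2 P (fun x y => part b (f x * g y)).
Proof.
move=> mf mg; case: b.
  apply: eq_moderate2 (moderate2D Pm (moderate2_prod Pm (mf false) (mg true))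
    (moderate2_prod Pm (mf true) (mg false))) => x y.
  by rewrite /part Im_mul.
apply: eq_moderate2 (moderate2B Pm (moderate2_prod Pm (mf false) (mg false))
  (moderate2_prod Pm (mf true) (mg true))) => x y.
by rewrite /part Re_mul.
Qed.

Lemma expect2_part b f g : cmoderate f -> cmoderate g ->
  expect2 P (fun x y => part b (f x * g y)) = part b (cexpect f * cexpect g).
Proof.
move=> mf mg; case: b.
  rewrite /= -[LHS]/(expect2 P (fun x y => complex.Im (f x * g y))).
  have -> : (fun x y => complex.Im (f x * g y)) = (fun x y =>
      part false (f x) * part true (g y) + part true (f x) * part false (g y)).
    by apply/funext => x; apply/funext => y; rewrite Im_mul.
  by rewrite (expect2D Pm) ?(expect2_prod Pm)//; exact: moderate2_prod.
rewrite /= -[LHS]/(expect2 P (fun x y => complex.Re (f x * g y))).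
have -> : (fun x y => complex.Re (f x * g y)) = (fun x y =>
    part false (f x) * part false (g y) - part true (f x) * part true (g y)).
  by apply/funext => x; apply/funext => y; rewrite Re_mul.
by rewrite (expect2B Pm) ?(expect2_prod Pm)//; exact: moderate2_prod.
Qed.

End complex_expectation.

Lemma is_time_derivative_parts (R : realType) (f : R -> R[i]) (t : R) (l : R[i]) :
    (forall b, (s - t)^-1 * (part b (f s) - part b (f t))
       @[s --> within (fun s : R => 0 <= s) t^'] --> part b l) ->
  is_time_derivative f t l.
Proof.
move=> H; rewrite /is_time_derivative; apply/cvgrPdist_le => /= e e0.
(* The tolerance ranges over [R[i]], where being positive forces it to be real. *)
have eR : e = (complex.Re e)%:C by rewrite RRe_real// ger0_real// ltW.
rewrite {}eR ltcR in e0 *; set r := complex.Re e in e0 *.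
have r2 : 0 < r / 2 by rewrite divr_gt0.
have /cvgrPdist_le /(_ _ r2) H0 := H false.
have /cvgrPdist_le /(_ _ r2) H1 := H true.
near=> s; rewrite -cnormE lecR (le_trans (cnorm_le_ReIm _))// [r]splitr.
rewrite -[complex.Re _]/(part false _) -[complex.Im _]/(part true _).
by rewrite !partB !partZ !partB lerD//; near: s.
Unshelve. all: by end_near. Qed.

(** * The resolvent as a test function *)

Section resolvent.
Variables (R : realType) (zeta : R[i]) (d : R).
Hypothesis d0 : 0 < d.
Hypothesis zeta_dist : forall p : R, 0 <= p -> d <= cnorm (zeta - p%:C).

Definition resolvent (p : R) : R[i] := (zeta - p%:C)^-1.

Let U := resolvent.

Lemma resolvent_neq0 p : 0 <= p -> zeta - p%:C != 0.
Proof. by move=> p0; rewrite -cnorm_gt0 (lt_le_trans d0)// zeta_dist. Qed.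

Lemma cnorm_resolvent p : 0 <= p -> cnorm (U p) <= d^-1.
Proof.
by move=> p0; rewrite cnormV lef_pV2 ?posrE ?zeta_dist// cnorm_gt0 resolvent_neq0.
Qed.

Lemma cnorm_resolventX (n : nat) p : 0 <= p -> cnorm (U p ^+ n) <= d^-1 ^+ n.
Proof.
move=> p0; rewrite cnormX lerXn2r ?nnegrE ?cnorm_ge0 ?invr_ge0 ?(ltW d0)//.
exact: cnorm_resolvent.
Qed.

(** The resolvent identity; the Lipschitz bound and both Taylor remainders below are obtained by
    iterating it. *)
Lemma resolventB p q : 0 <= p -> 0 <= q -> U q - U p = (q - p)%:C * (U p * U q).
Proof.
move=> p0 q0; rewrite rmorphB/= /U /resolvent; field.
by rewrite !resolvent_neq0.
Qed.

Let dV : 0 < d^-1. Proof. by rewrite invr_gt0. Qed.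

Lemma resolvent_lipschitz p q : 0 <= p -> 0 <= q ->
  cnorm (U p - U q) <= d^-1 ^+ 2 * `|p - q|.
Proof.
move=> p0 q0; rewrite resolventB// !cnormM cnorm_real mulrC ler_wpM2r// expr2.
by rewrite ler_pM ?cnorm_ge0// cnorm_resolvent.
Qed.

Lemma resolvent3_lipschitz p q : 0 <= p -> 0 <= q ->
  cnorm (2 * U p ^+ 3 - 2 * U q ^+ 3) <= 6 * d^-1 ^+ 4 * `|p - q|.
Proof.
move=> p0 q0.
have -> : 2 * U p ^+ 3 - 2 * U q ^+ 3 =
  (U p - U q) * (2%:R%:C * (U p ^+ 2 + U p * U q + U q ^+ 2)) by rewrite rmorph_nat; ring.
rewrite cnormM (cnormM 2%:R%:C) cnorm_real (@ger0_norm _ 2%:R)//.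
have H : cnorm (U p ^+ 2 + U p * U q + U q ^+ 2) <= 3 * d^-1 ^+ 2.
  rewrite (le_trans (cnormD _ _))// (le_trans (lerD (cnormD _ _) (lexx _)))//.
  have -> : 3 * d^-1 ^+ 2 = d^-1 ^+ 2 + d^-1 ^+ 2 + d^-1 ^+ 2 by ring.
  rewrite !lerD ?cnorm_resolventX// cnormM expr2.
  by rewrite ler_pM ?cnorm_ge0 ?cnorm_resolvent.
apply: le_trans (ler_pM (cnorm_ge0 _) _ (resolvent_lipschitz p0 q0) (ler_wpM2l (ler0n R 2) H)) _.
  by rewrite mulr_ge0 ?cnorm_ge0.
by rewrite le_eqVlt; apply/orP; left; apply/eqP; ring.
Qed.

Lemma resolvent_derivative b :
  halfline_derivative (fun p => part b (U p)) (fun p => part b (U p ^+ 2)).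
Proof.
exists (d^-1 ^+ 3) => p q p0 q0.
rewrite mulrC -partZ -!partB (le_trans (part_le_cnorm _ _))//.
have -> : U q - U p - (q - p)%:C * U p ^+ 2 =
    ((q - p) ^+ 2)%:C * (U p ^+ 2 * U q).
  have := resolventB p0 q0.
  rewrite rmorphXn/=; set h := (q - p)%:C => E.
  rewrite [X in X - _]E; transitivity (h * U p * (U q - U p)); first ring.
  by rewrite E; ring.
rewrite cnormM cnorm_real (ger0_norm (sqr_ge0 _)) mulrC ler_wpM2r ?sqr_ge0//.
by rewrite cnormM [d^-1 ^+ _]exprSr ler_pM ?cnorm_ge0 ?cnorm_resolventX ?cnorm_resolvent.
Qed.

Lemma resolvent2_derivative b :
  halfline_derivative (fun p => part b (U p ^+ 2)) (fun p => part b (2 * U p ^+ 3)).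
Proof.
exists (3 * d^-1 ^+ 4) => p q p0 q0.
rewrite mulrC -partZ -!partB (le_trans (part_le_cnorm _ _))//.
have -> : U q ^+ 2 - U p ^+ 2 - (q - p)%:C * (2 * U p ^+ 3) =
    ((q - p) ^+ 2)%:C * (U p ^+ 2 * U q ^+ 2 + 2%:R%:C * (U p ^+ 3 * U q)).
  have := resolventB p0 q0.
  rewrite rmorphXn rmorph_nat/=; set h := (q - p)%:C => E.
  transitivity ((U q - U p) * (U q + U p) - h * (2 * U p ^+ 3)); first ring.
  rewrite E; transitivity (h * U p * (U q - U p) * (U q + 2 * U p)); first ring.
  by rewrite E; ring.
rewrite cnormM cnorm_real (ger0_norm (sqr_ge0 _)) mulrC ler_wpM2r ?sqr_ge0//.
rewrite (le_trans (cnormD _ _))// (cnormM 2%:R%:C) cnorm_real (@ger0_norm _ 2%:R)//.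
have -> : 3 * d^-1 ^+ 4 = d^-1 ^+ 4 + 2 * d^-1 ^+ 4 by ring.
rewrite lerD// ?ler_wpM2l// cnormM.
  by rewrite (exprD _ 2 2) ler_pM ?cnorm_ge0 ?cnorm_resolventX.
by rewrite [d^-1 ^+ _]exprSr ler_pM ?cnorm_ge0 ?cnorm_resolventX ?cnorm_resolvent.
Qed.

Lemma resolvent_kernels b :
  difference_kernels (fun p => part b (U p)) (fun p => part b (U p ^+ 2))
    (fun p => part b (2 * U p ^+ 3)) (fun p q => part b (U p * U q))
    (fun p q => part b (zeta * U p ^+ 2 * U q)).
Proof.
move=> p q p0 q0; have np := resolvent_neq0 p0; have nq := resolvent_neq0 q0.
split.
- rewrite -partZ -partB; congr part; rewrite -[RHS]opprB resolventB//.
  by rewrite !rmorphB/=; ring.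
- rewrite -!partZ -partB; congr part; rewrite rmorphB/= /U /resolvent.
  by field; rewrite np nq.
- by rewrite expr2.
- rewrite -[2]/(2%:R) -!partZ -partD; congr part; rewrite rmorph_nat /U /resolvent.
  by field.
Qed.

Let lip_part (f : R -> R[i]) (L : R) b :
  (forall p q : R, 0 <= p -> 0 <= q -> cnorm (f p - f q) <= L * `|p - q|) ->
  forall p q : R, 0 <= p -> 0 <= q ->
    `|part b (f p) - part b (f q)| <= L * `|p - q|.
Proof. by move=> H p q p0 q0; rewrite -partB (le_trans (part_le_cnorm _ _))// H. Qed.

Lemma cmoderate_resolvent : cmoderate (fun x => U (x ^+ 2)).
Proof.
move=> b; apply: (moderate_lipschitz_sqr (G := fun p => part b (U p)) (L := d^-1 ^+ 2)).
  by rewrite exprn_ge0// ltW.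
by apply: lip_part; exact: resolvent_lipschitz.
Qed.

Lemma cmoderate_resolvent2 : cmoderate (fun x => U (x ^+ 2) ^+ 2).
Proof. exact: (cmoderateM cmoderate_resolvent cmoderate_resolvent). Qed.

Lemma cmoderate_monomial (s : nat) : cmoderate (fun x : R => (x ^+ s)%:C).
Proof. by apply: cmoderate_real; apply: moderateX; exact: moderate_id. Qed.

Section time.
Variables (nu0 : R) (c : nat -> R -> R).
Variable mu_ : R -> probability (measurableTypeR R) R.
Hypothesis nu0_ge0 : 0 <= nu0.
Hypothesis c_poly : forall (l : nat) (s : bool), exists p : {poly R},
  forall t : R, 0 <= t ->
  c (2 * l + s)%N t = p.[t] /\ p^`().[t] = moment_rate nu0 c s l t.
Hypothesis c_bound : forall T : R, 0 <= T -> exists2 A : R, 0 < A &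
  forall (l : nat) (t : R), 0 <= t <= T ->
    `|c (2 * l)%N t| <= A ^+ l * (2 * l)`!%:R.
Hypothesis mu_t_moments : forall t : R, 0 <= t -> has_moments (mu_ t) (c^~ t).

Let A (s : nat) (t : R) := cexpect (mu_ t) (fun x => (x ^+ s)%:C * U (x ^+ 2)).
Let B (s : nat) (t : R) := cexpect (mu_ t) (fun x => (x ^+ s)%:C * U (x ^+ 2) ^+ 2).

(** The test function theorem is applied to the real and imaginary parts; since both kernels of the
    resolvent are products, their double integrals become products of the transforms [A] and [B]. *)
Lemma resolvent_time_derivative (s : bool) (t : R) : 0 <= t ->
  is_time_derivative (A s) t
    (2 * nu0%:C * B s t + 4 * (zeta * B s t * A 0 t)
     - (if s then 0 else 2) * (A s t * A 0 t)).
Proof.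
move=> t0; apply: is_time_derivative_parts => b.
have L0 : 0 <= 6 * d^-1 ^+ 4 by rewrite mulr_ge0// exprn_ge0// ltW.
have mU := cmoderate_resolvent; have mU2 := cmoderate_resolvent2.
have mx := cmoderate_monomial s.
have mxU := cmoderateM mx mU; have mxU2 := cmoderateM mx mU2.
have SE : (fun x y : R => x ^+ s * part b (U (x ^+ 2) * U (y ^+ 2))) =
    (fun x y => part b ((x ^+ s)%:C * U (x ^+ 2) * U (y ^+ 2))).
  by apply/funext => x; apply/funext => y; rewrite -partZ mulrA.
have NE : (fun x y : R => x ^+ s * part b (zeta * U (x ^+ 2) ^+ 2 * U (y ^+ 2))) =
    (fun x y => part b ((zeta * ((x ^+ s)%:C * U (x ^+ 2) ^+ 2)) * U (y ^+ 2))).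
  by apply/funext => x; apply/funext => y; rewrite -partZ; congr part; ring.
have mz := cmoderateM (cmoderate_cst zeta) mxU2.
have mK r : 0 <= r ->
    moderate2 (mu_ r) (fun x y => x ^+ s * part b (U (x ^+ 2) * U (y ^+ 2))) /\
    moderate2 (mu_ r) (fun x y => x ^+ s * part b (zeta * U (x ^+ 2) ^+ 2 * U (y ^+ 2))).
  move=> r0; rewrite SE NE; have Pm := mu_t_moments r0.
  by split; exact: (moderate2_part Pm).
have H := @test_function_derivative R nu0 c mu_ nu0_ge0 c_poly c_bound mu_t_moments s
  _ _ _ _ _ _ t L0 (resolvent_derivative b) (resolvent2_derivative b)
  (lip_part (f := fun p => 2 * U p ^+ 3) b resolvent3_lipschitz) (resolvent_kernels b)
  (mU b) (mU2 b) mK t0.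
have Pm := mu_t_moments t0.
have gE r : expect (mu_ r) (fun x => x ^+ s * part b (U (x ^+ 2))) = part b (A s r).
  by rewrite part_cexpect; congr expect; apply/funext => x; rewrite partZ.
have A0E r : A 0 r = cexpect (mu_ r) (fun x => U (x ^+ 2)).
  by congr cexpect; apply/funext => x; rewrite expr0 mul1r.
have -> : part b (2 * nu0%:C * B s t + 4 * (zeta * B s t * A 0 t)
     - (if s then 0 else 2) * (A s t * A 0 t)) =
   test_rate nu0 mu_ s (fun p => part b (U p ^+ 2)) (fun p q => part b (U p * U q))
     (fun p q => part b (zeta * U p ^+ 2 * U q)) t.
  rewrite /test_rate SE NE !(expect2_part Pm)// (cexpectZ Pm)// -A0E -/(A s t) -/(B s t).
  have -> : expect (mu_ t) (fun x => x ^+ s * part b (U (x ^+ 2) ^+ 2)) = part b (B s t).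
    by rewrite part_cexpect; congr expect; apply/funext => x; rewrite partZ.
  rewrite -[4]/(4%:R) -[2 * nu0]/(2%:R * nu0) -!partZ -partD.
  have kE : (if s then 0 else 2 : R)%:C = if s then 0 else 2.
    by case: (s); rewrite ?rmorph0 ?rmorph_nat.
  by rewrite -partB kE; congr part; rewrite rmorphM !rmorph_nat/=; ring.
apply: cvg_trans H; apply: near_eq_cvg; near=> r.
by rewrite !gE.
Unshelve. all: by end_near. Qed.

End time.

End resolvent.

(** * Complex derivatives and the Stieltjes transforms *)

(** This remainder bound is stronger than differentiability, holds for integrals of resolvents, and
    passes through [w ^ 2] and multiplication by [w] by elementary estimates. *)
Definition quadratic_derivative (R : realType) (f : R[i] -> R[i]) (z l : R[i]) : Prop :=
  exists C d : R, 0 < d /\ forall h : R[i], cnorm h < d ->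
    cnorm (f (z + h) - f z - h * l) <= C * cnorm h ^+ 2.

Lemma quadratic_is_complex_derivative (R : realType) (f : R[i] -> R[i]) (z l : R[i]) :
  quadratic_derivative f z l -> is_complex_derivative f z l.
Proof.
move=> [C0 [d [d0 H0]]]; pose C : R := `|C0| + 1.
have C_gt0 : 0 < C by rewrite ltr_wpDl.
have H h : cnorm h < d -> cnorm (f (z + h) - f z - h * l) <= C * cnorm h ^+ 2.
  move=> /H0/le_trans; apply; rewrite ler_wpM2r ?exprn_ge0 ?cnorm_ge0//.
  by rewrite (le_trans (ler_norm _))// lerDl.
have cvg : h^-1 *: ((f \o shift z) (h *: (1 : R[i]^o)) - f z : R[i]^o)
    @[h --> (0 : R[i]^o)^'] --> (l : R[i]^o).
  apply/cvgrPdist_le => /= e e0.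
  have eR : e = (complex.Re e)%:C by rewrite RRe_real// ger0_real// ltW.
  rewrite {}eR ltcR in e0 *; set r := complex.Re e in e0 *.
  near=> h.
  have h0 : h != 0 by near: h; exact: (@nbhs_dnbhs_neq R[i]^o 0).
  have hd : cnorm h < d.
    by rewrite -ltcR cnormE; near: h; apply: (@dnbhs0_lt R[i] R[i]^o d%:C); rewrite ltcR.
  have he : cnorm h <= r / C.
    rewrite -lecR cnormE; near: h; apply: (@dnbhs0_le R[i] R[i]^o (r / C)%:C).
    by rewrite ltcR divr_gt0.
  rewrite -![_ *: _]/(_ * _) mulr1 -cnormE lecR.
  have -> : l - h^-1 * (f (h + z) - f z) = - h^-1 * (f (z + h) - f z - h * l).
    by rewrite (addrC h); field.
  rewrite cnormM cnormN cnormV ler_pdivrMl ?cnorm_gt0//.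
  rewrite (le_trans (H _ hd))// expr2 mulrCA ler_wpM2l ?cnorm_ge0//.
  by rewrite mulrC -ler_pdivlMr.
apply: DeriveDef; first exact: cvgP cvg.
exact: cvg_lim cvg.
Unshelve. all: by end_near. Qed.

Lemma eq_quadratic_derivative (R : realType) (f g : R[i] -> R[i]) (z l : R[i]) :
    (exists2 d : R, 0 < d & forall h, cnorm h < d -> f (z + h) = g (z + h)) ->
  quadratic_derivative f z l -> quadratic_derivative g z l.
Proof.
move=> [d d0 fg] [C [e [e0 H]]]; exists C, (Num.min d e).
split=> [|h]; first by rewrite lt_min d0.
rewrite lt_min => /andP[hd he]; rewrite -fg//.
have := fg 0; rewrite addr0 => <-; first exact: H.
by rewrite (_ : 0 = 0%:C) ?rmorph0// cnorm_real normr0.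
Qed.

Lemma quadratic_derivative_sqr (R : realType) (f : R[i] -> R[i]) (z l : R[i]) :
  quadratic_derivative f (z ^+ 2) l ->
  quadratic_derivative (fun w => f (w ^+ 2)) z (2 * z * l).
Proof.
move=> [C [d [d0 H]]]; pose M : R := 2 * cnorm z + 1.
have M0 : 0 < M by rewrite ltr_wpDl// mulr_ge0// cnorm_ge0.
exists (`|C| * M ^+ 2 + cnorm l), (Num.min 1 (d / M)); split.
  by rewrite lt_min ltr01 divr_gt0.
move=> h; rewrite lt_min => /andP[h1 hd].
pose k := 2 * z * h + h ^+ 2.
have hk : cnorm k <= M * cnorm h.
  rewrite (le_trans (cnormD _ _))// cnormX !cnormM.
  have -> : cnorm 2 = 2 :> R.
    by rewrite -[2]/(2%:R) -(rmorph_nat (real_complex R)) cnorm_real ger0_norm.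
  by have := cnorm_ge0 h; rewrite /M; nra.
have kd : cnorm k < d.
  by rewrite (le_lt_trans hk)// mulrC -ltr_pdivlMr.
have -> : (z + h) ^+ 2 = z ^+ 2 + k by rewrite /k; ring.
have -> : f (z ^+ 2 + k) - f (z ^+ 2) - h * (2 * z * l) =
   (f (z ^+ 2 + k) - f (z ^+ 2) - k * l) + h ^+ 2 * l by rewrite /k; ring.
rewrite (le_trans (cnormD _ _))// [X in _ <= X]mulrDl lerD//; last first.
  by rewrite cnormM cnormX mulrC.
rewrite (le_trans (H _ kd))// (le_trans (ler_wpM2r _ (ler_norm C)))//.
  by rewrite exprn_ge0 ?cnorm_ge0.
rewrite -mulrA ler_wpM2l// -exprMn lerXn2r// nnegrE ?cnorm_ge0//.
by rewrite mulr_ge0 ?cnorm_ge0// ltW.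
Qed.

Lemma quadratic_derivative_mul_id (R : realType) (f : R[i] -> R[i]) (z l : R[i]) :
  quadratic_derivative f z l ->
  quadratic_derivative (fun w => w * f w) z (f z + z * l).
Proof.
move=> [C [d [d0 H]]].
exists ((cnorm z + 1) * `|C| + cnorm l), (Num.min 1 d); split.
  by rewrite lt_min ltr01.
move=> h; rewrite lt_min => /andP[h1 hd].
have -> : (z + h) * f (z + h) - z * f z - h * (f z + z * l) =
   (z + h) * (f (z + h) - f z - h * l) + h ^+ 2 * l by ring.
rewrite (le_trans (cnormD _ _))// [X in _ <= X]mulrDl lerD//; last first.
  by rewrite cnormM cnormX mulrC.
rewrite cnormM -mulrA; apply: ler_pM; rewrite ?cnorm_ge0//.
  by rewrite (le_trans (cnormD _ _))// lerD2l ltW.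
rewrite (le_trans (H _ hd))// ler_wpM2r ?ler_norm// exprn_ge0 ?cnorm_ge0//.
Qed.

Section resolvent_transform.
Variables (R : realType) (P : probability (measurableTypeR R) R) (m : nat -> R).
Hypothesis Pm : has_moments P m.

Definition resolvent_transform (s k : nat) (zeta : R[i]) : R[i] :=
  cexpect P (fun x => (x ^+ s)%:C * resolvent zeta (x ^+ 2) ^+ k).

(** The remainder is exact under the integral: [1 / (a + h) - 1 / a + h / a ^ 2 = h ^ 2 / (a ^ 2 *
    (a + h))]. Restricting to [|h| < d / 2] keeps [zeta + h] at distance [d / 2] from the half-line,
    whence [K = d ^ -2 * (d / 2) ^ -1]. *)
Lemma resolvent_transform_derivative (s : bool) (zeta : R[i]) : off_halfline zeta ->
  quadratic_derivative (resolvent_transform s 1) zeta (- resolvent_transform s 2 zeta).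
Proof.
move=> /off_halfline_dist[d d0 dist].
pose u (x : R) := 1 + x ^+ 2; pose K := 2 * d^-1 ^+ 3.
have K0 : 0 <= K by rewrite mulr_ge0// exprn_ge0// invr_ge0 ltW.
have mu_u : moderate u.
  by apply: moderateD (moderate_cst 1) _; apply: moderateX; exact: moderate_id.
exists (2 * (K * expect P u)), (d / 2); split; first by rewrite divr_gt0.
move=> h hd; have d2 : 0 < d / 2 by rewrite divr_gt0.
have disth (p : R) : 0 <= p -> d / 2 <= cnorm (zeta + h - p%:C).
  move=> p0; have := dist p p0.
  have -> : zeta - p%:C = (zeta + h - p%:C) - h by ring.
  move=> /le_trans/(_ (cnormB _ _)) H.
  by move: H; rewrite {1}[d]splitr; move: hd; lra.
have mx := @cmoderate_monomial R s.
have m1 := cmoderate_resolvent d0 dist; have m2 := cmoderate_resolvent2 d0 dist.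
have m1h := cmoderate_resolvent d2 disth.
pose f1 (x : R) := (x ^+ s)%:C * resolvent (zeta + h) (x ^+ 2) ^+ 1.
pose f2 (x : R) := (x ^+ s)%:C * resolvent zeta (x ^+ 2) ^+ 1.
pose f3 (x : R) := (x ^+ s)%:C * resolvent zeta (x ^+ 2) ^+ 2.
have mf1 : cmoderate f1 by exact: cmoderateM.
have mf2 : cmoderate f2 by exact: cmoderateM.
have mf3 : cmoderate f3 by exact: cmoderateM.
have mf2' := cmoderateM (cmoderate_cst (-1)) mf2.
have mf3' := cmoderateM (cmoderate_cst h) mf3.
rewrite /resolvent_transform -/f1 -/f2 -/f3.
have -> : cexpect P f1 - cexpect P f2 - h * - cexpect P f3 =
    cexpect P (fun x => f1 x + -1 * f2 x + h * f3 x).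
  rewrite (cexpectD Pm)//; last exact: cmoderateD.
  rewrite (cexpectD Pm)// !(cexpectZ Pm)//; ring.
have m4 : cmoderate (fun x => f1 x + -1 * f2 x + h * f3 x).
  by apply: cmoderateD => //; exact: cmoderateD.
have -> : 2 * (K * expect P u) * cnorm h ^+ 2 =
    2 * expect P (fun x => K * cnorm h ^+ 2 * u x).
  by rewrite (expectZ Pm)//; ring.
apply: (cnorm_cexpect_le Pm) => //; first exact: moderateZ.
move=> x; have x20 := sqr_ge0 x.
have nz := resolvent_neq0 d0 dist x20; have nzh := resolvent_neq0 d2 disth x20.
have -> : f1 x + -1 * f2 x + h * f3 x = (x ^+ s)%:C *
    (h ^+ 2 * (resolvent zeta (x ^+ 2) ^+ 2 * resolvent (zeta + h) (x ^+ 2))).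
  rewrite /f1 /f2 /f3 /resolvent; move: nz nzh.
  by move: (x ^+ 2)%:C (x ^+ s)%:C => p v nz nzh; field; rewrite nz nzh.
rewrite cnormM cnorm_real mulrC.
have us : `|x ^+ s| <= u x by exact: norm_expr_bool_le.
apply: ler_pM; rewrite ?cnorm_ge0//.
rewrite cnormM cnormX mulrC ler_wpM2r ?exprn_ge0 ?cnorm_ge0//.
have H1 := cnorm_resolventX d0 dist 2 x20; have H2 := cnorm_resolvent d2 disth x20.
rewrite cnormM (le_trans (ler_pM (cnorm_ge0 _) (cnorm_ge0 _) H1 H2))//.
rewrite /K invfM invrK; rewrite le_eqVlt; apply/orP; left; apply/eqP; ring.
Qed.

Section stieltjes.
Variable z : R[i].
Hypothesis z0 : complex.Im z != 0.

Let V (x : R) : R[i] := (z - x%:C)^-1.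

Let Vneq0 x : z - x%:C != 0.
Proof.
apply/negP => /eqP H; move: z0; have -> : z = x%:C by rewrite -[z](subrK x%:C) H add0r.
by rewrite /= eqxx.
Qed.

Let a : R := `|complex.Im z|.

Let a0 : 0 < a. Proof. by rewrite normr_gt0. Qed.

Let Vbound x : cnorm (V x) <= a^-1.
Proof.
rewrite cnormV lef_pV2 ?posrE ?cnorm_gt0// /a.
by rewrite (le_trans _ (Im_le_cnorm _))//; case: (z) => ? ? /=; rewrite subr0.
Qed.

Let Vlip b x y : `|part b (V x) - part b (V y)| <= a^-1 ^+ 2 * `|x - y|.
Proof.
rewrite -partB (le_trans (part_le_cnorm _ _))//.
have -> : V x - V y = (x - y)%:C * (V x * V y).
  by rewrite rmorphB/= /V; field; rewrite !Vneq0.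
rewrite !cnormM cnorm_real mulrC ler_wpM2r// expr2.
by rewrite ler_pM ?cnorm_ge0.
Qed.

Let Vmoderate : cmoderate V.
Proof. by move=> b; apply: moderate_lipschitz (Vlip b); rewrite exprn_ge0// invr_ge0 ltW. Qed.

Let VNmoderate : cmoderate (fun x => V (- x)).
Proof.
move=> b; apply: moderate_lipschitz => [|x y]; last first.
  by apply: le_trans (Vlip b _ _) _; rewrite -opprD normrN.
by rewrite exprn_ge0// invr_ge0 ltW.
Qed.

Let Vmb b : measurable_bounded (fun x : measurableTypeR R => part b (V x)).
Proof.
split; first by apply: moderate_measurable; exact: Vmoderate.
by exists a^-1 => x; rewrite (le_trans (part_le_cnorm _ _)).
Qed.

(** Reflection averages the kernel over [x] and [- x], and the mean of [1 / (z - x)] and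
    [1 / (z + x)] is [z / (z ^ 2 - x ^ 2)]; the odd part below has the half-difference
    [x / (z ^ 2 - x ^ 2)]. *)
Lemma G_even_transform : G_even P z = z * resolvent_transform 0 1 (z ^+ 2).
Proof.
have sq_off := off_halfline_sqr z0; have [d d0 dist] := off_halfline_dist sq_off.
rewrite /resolvent_transform -(cexpectZ Pm); last first.
  exact: (cmoderateM (@cmoderate_monomial R 0) (cmoderate_resolvent d0 dist)).
apply: eq_part => b; rewrite part_cexpect.
transitivity (charge_integral (even_part P) (fun x => part b (V x))); first by case: b.
rewrite charge_integral_even//.
rewrite -[X in (X + _) / 2]/(expect P (fun x => part b (V x))).
rewrite -[X in (_ + X) / 2]/(expect P (fun x => part b (V (- x)))).
rewrite -(expectD Pm (Vmoderate b) (VNmoderate b)) mulrC -(expectZ Pm); last exact: moderateD.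
congr expect; apply/funext => x; rewrite -partD -partZ; congr part.
have n2 : z ^+ 2 - (x ^+ 2)%:C != 0 := resolvent_neq0 d0 dist (sqr_ge0 x).
have n1 := Vneq0 x; have n3 := Vneq0 (- x).
rewrite /V /resolvent fmorphV rmorph_nat expr0 mul1r expr1.
rewrite rmorphXn/= rmorphN/= opprK in n2 n3 *.
by move: x%:C n1 n2 n3 => p n1 n2 n3; field; rewrite n1 n2 n3.
Qed.

Lemma G_odd_transform : G_odd P z = resolvent_transform 1 1 (z ^+ 2).
Proof.
have sq_off := off_halfline_sqr z0; have [d d0 dist] := off_halfline_dist sq_off.
apply: eq_part => b; rewrite part_cexpect.
transitivity (charge_integral (odd_part P) (fun x => part b (V x))); first by case: b.
rewrite charge_integral_odd//.
rewrite -[X in (X - _) / 2]/(expect P (fun x => part b (V x))).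
rewrite -[X in (_ - X) / 2]/(expect P (fun x => part b (V (- x)))).
rewrite -(expectB Pm (Vmoderate b) (VNmoderate b)) mulrC -(expectZ Pm); last exact: moderateB.
congr expect; apply/funext => x; rewrite -partB -partZ; congr part.
have n2 : z ^+ 2 - (x ^+ 2)%:C != 0 := resolvent_neq0 d0 dist (sqr_ge0 x).
have n1 := Vneq0 x; have n3 := Vneq0 (- x).
rewrite /V /resolvent fmorphV rmorph_nat !expr1.
rewrite rmorphXn/= rmorphN/= opprK in n2 n3 *.
by move: x%:C n1 n2 n3 => p n1 n2 n3; field; rewrite n1 n2 n3.
Qed.

End stieltjes.

End resolvent_transform.

(** * The four differential equations *)

Lemma eq_time_derivative (R : realType) (f g : R -> R[i]) (t : R) (l : R[i]) :
    0 <= t -> (forall s, 0 <= s -> f s = g s) ->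
  is_time_derivative f t l -> is_time_derivative g t l.
Proof.
move=> t0 fg; apply: cvg_trans; apply: near_eq_cvg; rewrite near_withinE.
by near=> s => s0; rewrite !fg.
Unshelve. all: by end_near. Qed.

Lemma time_derivativeZ (R : realType) (a : R[i]) (f : R -> R[i]) (t : R) (l : R[i]) :
  is_time_derivative f t l -> is_time_derivative (fun s => a * f s) t (a * l).
Proof.
move=> H; rewrite /is_time_derivative.
have -> : (fun s => (s - t)^-1%:C * (a * f s - a * f t) : R[i]^o) =
   (fun s => (a : R[i]^o) *: ((s - t)^-1%:C * (f s - f t) : R[i]^o)).
  by apply/funext => s; rewrite -[_ *: _]/(a * _); ring.
exact: (@cvgZl_tmp R[i] R[i]^o).
Qed.

Unset Implicit Arguments.

Theorem proposition7p3 (R : realType)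
  (mu : probability (measurableTypeR R) R)
  (nu0 : R) (nu0_ge0 : 0 <= nu0)
  (c : nat -> R -> R)
  (mu_moments : has_moments mu (fun l => c l 0))
  (c_growth : exists2 K : R, 0 < K &
     forall l : nat, `|c l 0| <= (K * l%:R) ^+ l)
  (c_zero : forall t : R, 0 <= t -> c 0%N t = 1)
  (c_one : forall t : R, 0 <= t -> c 1%N t = c 1%N 0)
  (c_even : forall (l : nat) (t : R), (1 <= l)%N -> 0 <= t ->
     c (2 * l)%N t = c (2 * l)%N 0 +
       (2 * l)%:R * \int[lebesgue_measure]_(s in `[0, t])
         (nu0 * c (2 * l - 2)%N s +
          \sum_(0 <= h < l) c (2 * h)%N s * c (2 * l - 2 * h - 2)%N s))
  (c_odd : forall (l : nat) (t : R), (1 <= l)%N -> 0 <= t ->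
     c (2 * l + 1)%N t = c (2 * l + 1)%N 0 +
       \int[lebesgue_measure]_(s in `[0, t])
         ((2 * l)%:R * nu0 * c (2 * l - 1)%N s +
          4 * \sum_(0 <= h < l)
                (l - h)%:R * c (2 * h)%N s * c (2 * l - 2 * h - 1)%N s))
  (mu_ : R -> probability (measurableTypeR R) R)
  (mu_t_moments : forall t : R, 0 <= t -> has_moments (mu_ t) (c^~ t))
  (tGeven tGodd : R -> R[i] -> R[i])
  (tGeven_def : forall (t : R) (z : R[i]), 0 <= t -> complex.Im z != 0 ->
     G_even (mu_ t) z = z * tGeven t (z ^+ 2))
  (tGodd_def : forall (t : R) (z : R[i]), 0 <= t -> complex.Im z != 0 ->
     G_odd (mu_ t) z = tGodd t (z ^+ 2)) :
  forall (t : R) (z : R[i]), 0 <= t -> 0 < complex.Im z ->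
  exists tGeven_t tGeven_z tGodd_t tGodd_z Geven_t Geven_z Godd_t Godd_z : R[i],
  [/\ is_time_derivative (tGeven^~ z) t tGeven_t /\
        is_complex_derivative (tGeven t) z tGeven_z,
      is_time_derivative (tGodd^~ z) t tGodd_t /\
        is_complex_derivative (tGodd t) z tGodd_z,
      is_time_derivative (fun s => G_even (mu_ s) z) t Geven_t /\
        is_complex_derivative (G_even (mu_ t)) z Geven_z &
      is_time_derivative (fun s => G_odd (mu_ s) z) t Godd_t /\
        is_complex_derivative (G_odd (mu_ t)) z Godd_z] /\
  [/\ tGeven_t = - 2 * nu0%:C * tGeven_z - 4 * z * tGeven_z * tGeven t z
                 - 2 * tGeven t z ^+ 2,
      tGodd_t = (- 2 * nu0%:C - 4 * z * tGeven t z) * tGodd_z,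
      Geven_t = nu0%:C * (G_even (mu_ t) z / z ^+ 2 - Geven_z / z)
                - 2 * G_even (mu_ t) z * Geven_z &
      Godd_t = (- (nu0%:C / z) - 2 * G_even (mu_ t) z) * Godd_z].
Proof.
have c_poly := moment_poly c_zero c_one c_even c_odd.
have c_bound := moment_growth c_zero c_one c_even c_odd nu0_ge0 c_growth.
move=> t z t0 Imz.
have z0 : complex.Im z != 0 by rewrite gt_eqF.
have z_neq0 : z != 0 by apply: contraNneq z0 => ->.
have z_off : off_halfline z by left.
have z2_off := off_halfline_sqr z0.
pose A (s : nat) (r : R) (w : R[i]) := resolvent_transform (mu_ r) s 1 w.
pose B (s : nat) (r : R) (w : R[i]) := resolvent_transform (mu_ r) s 2 w.
(* The given functions are identified with integrals of resolvents off the half-line, by writing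
   each point as the square of a nonreal number. *)
have evenE (r : R) (w : R[i]) : 0 <= r -> off_halfline w -> tGeven r w = A 0 r w.
  move=> r0 /off_halfline_sqrt[v v0 ->].
  have v_neq0 : v != 0 by apply: contraNneq v0 => ->.
  apply: (mulfI v_neq0); rewrite -tGeven_def//.
  exact: (G_even_transform (mu_t_moments r r0)).
have oddE (r : R) (w : R[i]) : 0 <= r -> off_halfline w -> tGodd r w = A 1 r w.
  move=> r0 /off_halfline_sqrt[v v0 ->]; rewrite -tGodd_def//.
  exact: (G_odd_transform (mu_t_moments r r0)).
have dt (s : bool) (w : R[i]) : off_halfline w -> is_time_derivative (fun r => A s r w) t
    (2 * nu0%:C * B s t w + 4 * (w * B s t w * A 0 t w)
     - (if s then 0 else 2) * (A s t w * A 0 t w)).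
  move=> /off_halfline_dist[d d0 dist].
  have := resolvent_time_derivative d0 dist nu0_ge0 c_poly c_bound mu_t_moments (s := s) t0.
  have E (s' : nat) r : cexpect (mu_ r) (fun x => (x ^+ s')%:C * resolvent w (x ^+ 2)) = A s' r w.
    by congr cexpect; apply/funext => x; rewrite expr1.
  rewrite !E; apply: eq_time_derivative => // r r0; exact: E.
have dz (s : bool) (w : R[i]) : off_halfline w -> quadratic_derivative (A s t) w (- B s t w).
  exact: (resolvent_transform_derivative (mu_t_moments t t0)).
have near_off : exists2 d : R, 0 < d & forall h, cnorm h < d -> off_halfline (z + h).
  exact: off_halfline_near.
have near_Im : exists2 d : R, 0 < d & forall h, cnorm h < d -> complex.Im (z + h) != 0.
  exists (complex.Im z) => // h hz; have := le_lt_trans (Im_le_cnorm h) hz.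
  rewrite ltr_norml => /andP[hz1 _]; rewrite gt_eqF//.
  by move: hz1; case: (z) (h) => [? ?] [? ?] /=; lra.
have [d1 d10 near_off1] := near_off; have [d2 d20 near_Im2] := near_Im.
(* The time derivatives are those of [dt], including the coefficient 2 or 0 that depends on the
   parity. The derivatives in [z] are [- B], combined for [G_even] and [G_odd] with the chain rule
   for [z ^ 2] and, in the even case, the product rule. *)
exists (2 * nu0%:C * B 0 t z + 4 * (z * B 0 t z * A 0 t z) - 2 * (A 0 t z * A 0 t z)).
exists (- B 0 t z).
exists (2 * nu0%:C * B 1 t z + 4 * (z * B 1 t z * A 0 t z) - 0 * (A 1 t z * A 0 t z)).
exists (- B 1 t z).
exists (z * (2 * nu0%:C * B 0 t (z ^+ 2) + 4 * (z ^+ 2 * B 0 t (z ^+ 2) * A 0 t (z ^+ 2))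
   - 2 * (A 0 t (z ^+ 2) * A 0 t (z ^+ 2)))).
exists (A 0 t (z ^+ 2) + z * (2 * z * - B 0 t (z ^+ 2))).
exists (2 * nu0%:C * B 1 t (z ^+ 2) + 4 * (z ^+ 2 * B 1 t (z ^+ 2) * A 0 t (z ^+ 2))
   - 0 * (A 1 t (z ^+ 2) * A 0 t (z ^+ 2))).
exists (2 * z * - B 1 t (z ^+ 2)).
have GevenE (r : R) (w : R[i]) : 0 <= r -> complex.Im w != 0 ->
    G_even (mu_ r) w = w * A 0 r (w ^+ 2).
  by move=> r0 w0; exact: (G_even_transform (mu_t_moments r r0)).
have GoddE (r : R) (w : R[i]) : 0 <= r -> complex.Im w != 0 -> G_odd (mu_ r) w = A 1 r (w ^+ 2).
  by move=> r0 w0; exact: (G_odd_transform (mu_t_moments r r0)).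
split.
  split; split.
  - apply: eq_time_derivative (dt false z z_off) => // r r0; exact/esym/evenE.
  - apply: quadratic_is_complex_derivative.
    apply: eq_quadratic_derivative (dz false z z_off).
    by exists d1 => // h /near_off1 ?; exact/esym/evenE.
  - apply: eq_time_derivative (dt true z z_off) => // r r0; exact/esym/oddE.
  - apply: quadratic_is_complex_derivative.
    apply: eq_quadratic_derivative (dz true z z_off).
    by exists d1 => // h /near_off1 ?; exact/esym/oddE.
  - have /= H0 := dt false (z ^+ 2) z2_off.
    have H := time_derivativeZ (a := z) H0.
    by apply: eq_time_derivative H => // r r0; exact/esym/GevenE.
  - apply: quadratic_is_complex_derivative.
    apply: eq_quadratic_derivative (quadratic_derivative_mul_id
      (quadratic_derivative_sqr (dz false (z ^+ 2) z2_off))).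
    by exists d2 => // h /near_Im2 ?; exact/esym/GevenE.
  - apply: eq_time_derivative (dt true (z ^+ 2) z2_off) => // r r0; exact/esym/GoddE.
  - apply: quadratic_is_complex_derivative.
    apply: eq_quadratic_derivative (quadratic_derivative_sqr (dz true (z ^+ 2) z2_off)).
    by exists d2 => // h /near_Im2 ?; exact/esym/GoddE.
rewrite evenE// GevenE//.
(* Once the transforms are replaced by independent variables, the four equations are rational
   identities, the last two using [z != 0]. *)
move: (A 0 t z) (A 1 t z) (B 0 t z) (B 1 t z) (A 0 t (z ^+ 2)) (A 1 t (z ^+ 2))
  (B 0 t (z ^+ 2)) (B 1 t (z ^+ 2)) => a0 a1 b0 b1 a0' a1' b0' b1'.
split.
- by ring.
- by ring.
- by field.
- by field.
Qed.
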